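(* Let $n\ge2$ and $\pi,\tau\in S_n$. Then $\pi\sim\tau$ if and only if $\tau$ can be obtained from $\pi$ by a sequence of valid flips, i.e. there exist $\pi_0=\pi,\pi_1,\dots,\pi_l=\tau\in S_n$ ($l\ge0$) and, for each $1\le r\le l$, a flip $\varphi_r$ that is a valid flip with respect to $\pi_{r-1}$ such that $\{(\varphi_r(S^{\pi_{r-1}}_m),\varepsilon^{\pi_{r-1}}_m):1\le m\le n-1\}=\{(S^{\pi_r}_m,\varepsilon^{\pi_r}_m):1\le m\le n-1\}$.
   Context: For $x=(x_1,\dots,x_{n-1})\in\mathbb{R}^{n-1}$ put $Z_0=0$ and $Z_i=x_1+\dots+x_i$. If $Z_0,\dots,Z_{n-1}$ are pairwise distinct, let $p(x)\in S_n$ be the permutation with the same relative order as $(Z_0,\dots,Z_{n-1})$, i.e. $p(x)(i)=|\{k: Z_k\le Z_{i-1}\}|$; otherwise $p(x)$ is undefined (and ''$p(x)=\pi$'' is false). Write $\pi\sim\tau$ if there is $\rho\in S_{n-1}$ such that for all $x\in\mathbb{R}^{n-1}$: $p(x_1,\dots,x_{n-1})=\pi$ iff $p(x_{\rho(1)},\dots,x_{\rho(n-1)})=\tau$. For $1\le s<t\le n$, the interval $[s,t]$ has level set $\Lambda_{[s,t]}=\{s,\dots,t-1\}$. For $\pi\in S_n$ and $1\le m\le n-1$, $S^\pi_m=\Lambda_{[\min(\pi(m),\pi(m+1)),\max(\pi(m),\pi(m+1))]}$ and $\varepsilon^\pi_m=\operatorname{sgn}(\pi(m+1)-\pi(m))$;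 for $\sigma\in S_{n-1}$, $\sigma(S)=\{\sigma(x):x\in S\}$. The flip of $[i,j]$ ($1\le i<j\le n$) is $\varphi\in S_{n-1}$ with $\varphi(m)=i+j-1-m$ for $i\le m\le j-1$ and $\varphi(m)=m$ otherwise. It is a valid flip with respect to $\pi$ if, with $p<q$ such that $\{p,q\}=\{\pi(1),\pi(n)\}$: (a) $\Lambda_{[i,j]}\subseteq\Lambda_{[p,q]}$ or $\Lambda_{[p,q]}\subseteq\Lambda_{[i,j]}$ or $\Lambda_{[i,j]}\cap\Lambda_{[p,q]}=\emptyset$; and (b) for every $m$, $S^\pi_m\subseteq\Lambda_{[i,j]}$ or $\Lambda_{[i,j]}\subseteq S^\pi_m$ or $S^\pi_m\cap\Lambda_{[i,j]}=\emptyset$. *)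

(* Defs.v *)
From HB Require Import structures.
From mathcomp Require Import all_boot all_order all_algebra all_fingroup.
From mathcomp Require Import reals zify.

Set Implicit Arguments.
Unset Strict Implicit.
Unset Printing Implicit Defensive.

Import Order.TTheory GRing.Theory Num.Theory.
Local Open Scope ring_scope.

(* The n of the mathematical text is n.+1 here.  Positions and values of a    *)
(* permutation, {1, ..., n} in the text, are elements of 'I_n.+1; step        *)
(* indices and levels, {1, ..., n-1} in the text, are elements of 'I_n.  All  *)
(* of them are shifted down by one, whereas the indices 0, ..., n-1 of the    *)
(* partial sums Z are unchanged.                                              *)

Section Pattern.
Variables (R : realType) (n : nat).
Implicit Types (x : 'rV[R]_n) (pi tau : 'S_n.+1).

Definition partial_sum x (i : 'I_n.+1) : R := \sum_(k < n | (k < i)%N) x 0 k.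

(* The graph of the partial function p: p(x) is defined and equals pi.  The   *)
(* successor turns the value pi i into its counterpart in {1, ..., n}.        *)
Definition has_pattern x pi : Prop :=
  injective (partial_sum x) /\
  forall i, (pi i).+1 = #|[set k | partial_sum x k <= partial_sum x i]|.

Definition pattern_equiv pi tau : Prop :=
  exists rho : 'S_n, forall x : 'rV[R]_n,
    has_pattern x pi <-> has_pattern (col_perm rho x) tau.

End Pattern.

Arguments pattern_equiv R {n} pi tau.

Section Flip.
Variable n : nat.
Implicit Types (pi tau : 'S_n.+1) (m : 'I_n) (i j : 'I_n.+1).

Definition level_set (s t : nat) : {set 'I_n} := [set k : 'I_n | s <= k < t]%N.

Definition step_src pi m : 'I_n.+1 := pi (widen_ord (leqnSn n) m).
Definition step_dst pi m : 'I_n.+1 := pi (lift ord0 m).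

Definition step_set pi m : {set 'I_n} :=
  level_set (minn (step_src pi m) (step_dst pi m))
            (maxn (step_src pi m) (step_dst pi m)).

Definition step_sign pi m : int :=
  Num.sg ((step_dst pi m)%:Z - (step_src pi m)%:Z).

(* With indices starting at 0, the formula i + j - 1 - m keeps its shape; the *)
(* default value m of insubd is never used in the first branch.               *)
Definition flip_fun i j m : 'I_n :=
  if (i <= m < j)%N then insubd m (i + j - 1 - m)%N else m.

Lemma val_flip_fun i j m :
  flip_fun i j m = (if i <= m < j then i + j - 1 - m else m)%N :> nat.
Proof.
rewrite /flip_fun; case: ifP => // /andP[im mj].
by rewrite val_insubd ifT //; have := ltn_ord j; lia.
Qed.

Lemma flip_funK i j : involutive (flip_fun i j).
Proof.
move=> m; apply: val_inj => /=; rewrite !val_flip_fun.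
by case: (boolP (i <= m < j)%N) => [/andP[im mj]|/negbTE ->//]; rewrite ifT; lia.
Qed.

Definition flip i j : 'S_n := perm (inv_inj (flip_funK i j)).

Definition laminar (A B : {set 'I_n}) : bool :=
  [|| A \subset B, B \subset A | A :&: B == set0].

Definition valid_flip pi i j : Prop :=
  [/\ (i < j)%N,
      laminar (level_set i j)
              (level_set (minn (pi ord0) (pi ord_max))
                         (maxn (pi ord0) (pi ord_max)))
    & forall m, laminar (step_set pi m) (level_set i j)].

(* =i between the two image sequences is equality of the underlying sets.     *)
Definition flip_step pi tau : Prop :=
  exists i j, valid_flip pi i j /\
    [seq (flip i j @: step_set pi m, step_sign pi m) | m : 'I_n] =i
    [seq (step_set tau m, step_sign tau m) | m : 'I_n].

Definition flip_connected pi tau : Prop :=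
  exists (l : nat) (s : nat -> 'S_n.+1),
    [/\ s 0 = pi, s l = tau
      & forall r, (r < l)%N -> flip_step (s r) (s r.+1)].

End Flip.

(* Main.v *)
(* Writing the steps of a walk with pattern pi through the positive gaps y      *)
(* between consecutive values gives x_m = eps_m * sum_{k in S_m} y_k: the walks *)
(* with pattern pi form the image of the positive orthant under an invertible   *)
(* matrix with entries in {0, 1, -1}.  A permutation of the steps maps one such *)
(* cone onto another iff it comes from a permutation s of the levels that       *)
(* carries the signed sets (S_m, eps_m) of pi to those of tau, because a        *)
(* nonnegative matrix with nonnegative inverse is monomial.                     *)
(*   Such an s makes the sets S_m, and the set of levels between the endpoints  *)
(* (on which the signed sets add up), intervals again.  Any two linear orders   *)
(* in which all members of a family of sets are intervals are related by        *)
(* reversals of intervals that overlap no member: contract a set that overlaps  *)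
(* no member and is an interval of both orders; when there is none, either      *)
(* there are no overlaps at all, or the overlaps form one component that        *)
(* determines the order up to reversal.  Finally, each intermediate family      *)
(* comes from a permutation: its signed intervals are the edges of a connected  *)
(* digraph whose in- and out-degrees are those of a path.                       *)

Require Import Defs.
From mathcomp Require Import all_boot all_order all_algebra all_fingroup.
From mathcomp Require Import reals boolp zify lra ring.

Set Implicit Arguments.
Unset Strict Implicit.
Unset Printing Implicit Defensive.

Import Order.TTheory GRing.Theory Num.Theory.

(** * Linear orders with prescribed intervals *)

(** Both relations are compared with [level_iso]: a permutation [s] of the levels that carries the
    signed level sets of one permutation onto those of the other. By [has_patternP] a pattern is a
    simplicial cone. A coordinate permutation that matches two such cones induces a bijection of the
    gap orthants; [nonneg_inverse_perm] makes it monomial, and the entries 0, 1, -1 exclude any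
    scaling. This gives [step_mx_pattern_equiv], with converse [pattern_equiv_step_mx]. A valid flip
    is a special level isomorphism, which settles one direction.

    For the other, let [s] be a level isomorphism from [pi] to [tau]. The step sets of [pi] and its
    endpoint interval are intervals of the natural order of the levels. They are also intervals of
    the order that puts level [k] at position [s k], since [s] maps them to the corresponding
    intervals of [tau] ([level_iso_family]). By [flips_connected], noncrossing reversals lead from
    the first order to the second. By [flips_flip_connected] each of them is a valid flip, whose
    target permutation is supplied by [level_iso_realize]. The final permutation is reached through
    the same [s] as [tau], so it equals [tau] by [level_iso1]. *)

Section Before.
Variable T : eqType.
Implicit Types (s t : seq T) (x y z : T).

(** Encoded by [subseq], so that the relation passes to larger sequences by transitivity and to
    reversals at once. *)
Definition before s x y := subseq [:: x; y] s.

Lemma before_index s x y : uniq s ->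
  before s x y = [&& x \in s, y \in s & index x s < index y s].
Proof.
rewrite /before; elim: s => //= a s IHs /andP[anins us].
rewrite !inE ![_ == a]eq_sym; case: (eqVneq a x) => [<-|ax] /=.
  rewrite sub1seq; case: (eqVneq a y) => [<-|//] /=; first exact: negbTE.
  by rewrite andbT.
rewrite IHs //; case: (eqVneq a y) => [<-|//] /=.
by rewrite (negbTE anins) !andbF.
Qed.

Lemma before_mem s x y : before s x y -> (x \in s) && (y \in s).
Proof. by move=> /mem_subseq sub; rewrite !sub ?inE ?eqxx ?orbT. Qed.

Lemma before_rev s x y : before (rev s) x y = before s y x.
Proof. by rewrite /before -[in RHS]subseq_rev. Qed.

Lemma before_antisym s x y : uniq s -> x \in s -> y \in s -> x != y ->
  before s y x = ~~ before s x y.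
Proof.
move=> us xs ys xy; rewrite !before_index // xs ys /= -leqNgt.
rewrite ltn_neqAle; case: eqP => //= eqi; case/eqP: xy.
by rewrite -(nth_index x xs) -(nth_index x ys) eqi.
Qed.

(** The position of an element is the number of elements before it, so the relation [before] fixes
    all positions. *)
Lemma eq_before s t : uniq s -> uniq t -> perm_eq s t ->
  (forall x y, x \in s -> y \in s -> x != y -> before s x y = before t x y) ->
  s = t.
Proof.
move=> us ut st eqb.
have idx r : uniq r -> {in r, forall x, index x r = count (before r ^~ x) r}.
  move=> ur x xr; rewrite (eq_in_count (a2 := [in take (index x r) r])); last first.
    by move=> y yr; rewrite before_index // yr xr /= in_take.
  set i := index x r; have er : r = take i r ++ drop i r by rewrite cat_take_drop.
  have := ur; rewrite {1}er cat_uniq => /and3P[_ nod _].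
  have -> : count [in take i r] r = count [in take i r] (take i r ++ drop i r).
    by rewrite -er.
  rewrite count_cat.
  have -> : count [in take i r] (drop i r) = 0 by apply/eqP; rewrite eqn0Ngt -has_count.
  have /eqP-> : count [in take i r] (take i r) == size (take i r).
    by rewrite -all_count; apply/allP.
  by rewrite addn0 size_takel ?index_size.
case: s us st eqb => [|x0 s'] us st eqb.
  by apply/esym/nilP; rewrite /nilp -(perm_size st).
set s := x0 :: s' in us st eqb *.
have eqi : {in s, forall x, index x s = index x t}.
  move=> x xs; rewrite !idx -?(perm_mem st) // (seq.permP st).
  apply: eq_in_count => y; rewrite -(perm_mem st) => ys.
  case: (eqVneq y x) => [->|yx]; last by rewrite eqb.
  by rewrite !before_index // !ltnn !andbF.
apply: (@eq_from_nth _ x0) => [|i si]; first exact: perm_size.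
have xs := mem_nth x0 si; have xt := xs; rewrite (perm_mem st) in xt.
by rewrite -[LHS](nth_index x0 xt) -eqi // index_uniq.
Qed.

End Before.

(** * Intervals of a linear order *)

Section Convex.
Variable T : finType.
Implicit Types (s t : seq T) (A : {set T}) (x y z : T).

Definition convex s A := forall x y z,
  before s x y -> before s y z -> x \in A -> z \in A -> y \in A.

Lemma convex_subseq s t A : subseq t s -> convex s A -> convex t A.
Proof.
by move=> ts cA x y z /subseq_trans/(_ ts) + /subseq_trans/(_ ts); apply: cA.
Qed.

Lemma convex_rev s A : convex s A -> convex (rev s) A.
Proof. by move=> cA x y z; rewrite !before_rev => yx zy xA zA; apply: (cA z y x). Qed.

Lemma convexI s A : convex s A -> convex s (A :&: [set x in s]).
Proof.
move=> cA x y z xy yz; rewrite !inE => /andP[xA _] /andP[zA _].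
by have /andP[_ ->] := before_mem xy; rewrite (cA _ _ _ xy yz).
Qed.

Lemma convex_side s A x x' y : uniq s -> convex s A ->
  x \in s -> x' \in s -> y \in s -> x \in A -> x' \in A -> y \notin A ->
  before s x y = before s x' y.
Proof.
move=> us cA xs x's ys xA x'A yA.
have half x1 x2 : x2 \in s -> x1 \in A -> x2 \in A -> before s x1 y -> before s x2 y.
  move=> x2s x1A x2A x1y; have yx2 : y != x2 by apply: contraNneq yA => ->.
  rewrite before_antisym //; apply: contraNN yA => yx2'; exact: cA x1y yx2' _ _.
by apply/idP/idP; apply: half.
Qed.

(** Exhibits an interval as a contiguous block, the form in which it can be contracted. *)
Lemma convex_split s A : uniq s -> convex s A -> exists u m w,
  [/\ s = u ++ m ++ w, {subset m <= A}, {in s, forall x, x \in A -> x \in m}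
    & {in m, forall x, x \notin u ++ w}].
Proof.
elim: s => [|a s IHs] /= us cA; first by exists [::], [::], [::].
have [anins uns] := andP us.
have [||u [m [w [es mA Am mN]]]] := IHs; first by [].
  by apply: convex_subseq cA; apply: subseq_cons.
case: (boolP (a \in A)) => [aA|aA]; last first.
  exists (a :: u), m, w; split=> //=; first by rewrite es.
    by move=> x; rewrite inE => /predU1P[->|xs]; [rewrite (negbTE aA) | apply: Am].
  move=> x xm; rewrite inE negb_or mN // andbT; apply: contraNneq anins => <-.
  by rewrite es !mem_cat xm orbT.
case: m es mA Am mN => [|b m] es mA Am mN.
  exists [::], [:: a], s; split=> //.
  - by move=> x; rewrite inE => /eqP->.
  - by move=> x; rewrite !inE => /predU1P[->|/Am/[apply]//]; rewrite eqxx.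
  - by move=> x; rewrite inE => /eqP->.
have u0 : u = [::].
  case: u es mN => // c u es mN.
  have cA' : c \in A.
    apply: (cA a c b) => //; last by apply: mA; rewrite mem_head.
      by rewrite /before /= eqxx sub1seq es mem_head.
    rewrite /before es -[[:: c; b]]/([::] ++ [:: c; b]).
    apply: (@cat_subseq _ _ _ [:: a]) => //=; rewrite eqxx sub1seq.
    by rewrite !mem_cat mem_head orbT.
  have := Am c; rewrite es mem_head => /(_ isT cA') /mN.
  by rewrite mem_head.
rewrite {}u0 /= in es mN; exists [::], [:: a, b & m], w; split=> //=.
- by rewrite es.
- by move=> x; rewrite inE => /predU1P[->//|]; apply: mA.
- by move=> x; rewrite !inE => /predU1P[->|xs xA]; rewrite ?eqxx // -in_cons Am ?orbT.
- move=> x; rewrite inE => /predU1P[->|]; last exact: mN.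
  by apply: contraNN anins; rewrite es inE mem_cat => ->; rewrite !orbT.
Qed.

End Convex.

(** * Noncrossing reversals and the contraction of blocks *)

Section Flips.
Variables (T : finType) (I : Type) (F : I -> {set T}).
Implicit Types (s t u v w m : seq T) (A : {set T}) (x y z : T).

(** The counterpart of [laminar] for a segment [v] of [s] and the trace of [A] on [s]. *)
Definition noncrossing s (v : {pred T}) A :=
  [\/ {subset v <= A}, {in v, forall x, x \notin A}
    | {in s, forall x, x \in A -> x \in v}].

Lemma noncrossing_sub s s' (v : {pred T}) A :
  {subset s' <= s} -> noncrossing s v A -> noncrossing s' v A.
Proof.
move=> ss' [vA|vA|Av]; [exact: Or31|exact: Or32|apply: Or33].
by move=> x /ss'; apply: Av.
Qed.

Lemma noncrossing_trans s m (v : {pred T}) A :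
  {subset v <= m} -> noncrossing s (mem m) A -> noncrossing m v A -> noncrossing s v A.
Proof.
move=> vm [mA|mA|Am] nv; first by apply: Or31 => x /vm/mA.
  by apply: Or32 => x /vm/mA.
case: nv => [vA|vA|Av]; [exact: Or31|exact: Or32|apply: Or33].
by move=> x xs xA; apply: Av => //; apply: Am.
Qed.

Inductive flips : seq T -> seq T -> Prop :=
| Flips0 s : flips s s
| FlipsS u v w t : (forall i, noncrossing (u ++ v ++ w) (mem v) (F i)) ->
    flips (u ++ rev v ++ w) t -> flips (u ++ v ++ w) t.

Lemma flips_trans s t w : flips s t -> flips t w -> flips s w.
Proof. by elim=> // {s t} u v w' t nc _ IH /IH; apply: FlipsS. Qed.

Lemma flip1 u v w : (forall i, noncrossing (u ++ v ++ w) (mem v) (F i)) ->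
  flips (u ++ v ++ w) (u ++ rev v ++ w).
Proof. by move=> nc; apply: FlipsS nc _; apply: Flips0. Qed.

Lemma flips_rev s : flips s (rev s).
Proof.
have := @flip1 [::] s [::]; rewrite !cats0; apply=> i.
by apply: Or33 => x.
Qed.

(** A segment noncrossing inside a noncrossing block is noncrossing in the whole order, so blocks
    can be rearranged in place. *)
Lemma flips_ctx u w m m' : (forall i, noncrossing (u ++ m ++ w) (mem m) (F i)) ->
  flips m m' -> flips (u ++ m ++ w) (u ++ m' ++ w).
Proof.
move=> nc fl; elim: fl nc => {m m'} [s|a v b t nv _ IH] nc; first exact: Flips0.
rewrite -!catA catA; apply: FlipsS => [i|].
  rewrite -catA [v ++ _]catA [a ++ _]catA.
  apply: noncrossing_trans (nc i) (nv i) => x xv.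
  by rewrite !mem_cat (xv : x \in v) orbT.
rewrite -catA [rev v ++ _]catA [a ++ _]catA; apply: IH => i.
have pm : perm_eq (a ++ v ++ b) (a ++ rev v ++ b).
  by rewrite perm_cat2l perm_cat2r perm_sym perm_rev.
have eqm : mem (a ++ v ++ b) =i mem (a ++ rev v ++ b) by move=> x; apply: perm_mem.
case: (nc i) => [vA|vA|Av]; [apply: Or31|apply: Or32|apply: Or33].
- by move=> x; rewrite -eqm; apply: vA.
- by move=> x; rewrite -eqm; apply: vA.
- by move=> x xs xA; rewrite -eqm; apply: Av => //; move: xs; rewrite !mem_cat mem_rev.
Qed.

(** Without constraints, reversing the prefix that ends at the first element of [t] brings that
    element to the front; the tail follows by induction. *)
Lemma flips_free s t :
  (forall v, {subset v <= s} -> forall i, noncrossing s (mem v) (F i)) ->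
  perm_eq s t -> flips s t.
Proof.
elim: t s => [|x t IHt] s free st; first by move/perm_nilP: st => ->; apply: Flips0.
have xs : x \in s by rewrite (perm_mem st) mem_head.
case/splitPr: xs free st => u w free st.
apply: (@flips_trans _ (x :: rev u ++ w)).
  have := @flip1 [::] (rcons u x) w; rewrite rev_rcons /= cat_rcons; apply=> i.
  by apply: free => y; rewrite mem_rcons mem_cat !inE => /orP[->|->]; rewrite ?orbT.
have ux : perm_eq (u ++ x :: w) (x :: rev u ++ w).
  rewrite -cat1s perm_catCA /= perm_cons perm_cat2r perm_sym.
  by rewrite perm_rev.
have free' v : {subset v <= x :: rev u ++ w} ->
    forall i, noncrossing (x :: rev u ++ w) (mem v) (F i).
  move=> vs i; apply: (noncrossing_sub (s := u ++ x :: w)).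
    by move=> y; rewrite (perm_mem ux).
  by apply: free => y /vs; rewrite (perm_mem ux).
have := @flips_ctx [:: x] [::] (rev u ++ w) t; rewrite !cats0; apply.
  by move=> i; apply: free' => y yu; rewrite inE yu orbT.
apply: IHt => [v vs i|].
  apply: (noncrossing_sub (s := x :: rev u ++ w)) => [y yu|].
    by rewrite inE yu orbT.
  by apply: free' => y /vs yu; rewrite inE yu orbT.
by rewrite -(perm_cons x) -(permPl ux).
Qed.

(* [expand x m] undoes the contraction of the block [m] to one of its points [x]. *)
Definition expand x m s := flatten [seq if y == x then m else [:: y] | y <- s].

Lemma expand_cat x m s t : expand x m (s ++ t) = expand x m s ++ expand x m t.
Proof. by rewrite /expand map_cat flatten_cat. Qed.

Lemma expand_notin x m s : x \notin s -> expand x m s = s.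
Proof.
elim: s => //= y s IHs; rewrite inE negb_or eq_sym => /andP[/negbTE yx xs].
by rewrite -[RHS]cat1s -[in RHS](IHs xs) /expand /= yx.
Qed.

Lemma expand_one x m : expand x m [:: x] = m.
Proof. by rewrite /expand /= eqxx cats0. Qed.

Lemma expand_rev x m s : rev (expand x m s) = expand x (rev m) (rev s).
Proof.
elim: s => // y s IHs; rewrite -cat1s expand_cat !rev_cat expand_cat IHs.
by congr (_ ++ _); rewrite /expand /=; case: eqP; rewrite !cats0.
Qed.

Lemma mem_expand x m s z :
  (z \in expand x m s) = (z != x) && (z \in s) || (x \in s) && (z \in m).
Proof.
elim: s => [|y s IHs]; first by rewrite andbF.
rewrite -cat1s expand_cat mem_cat {}IHs /expand /= cats0 !inE [x == y]eq_sym.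
case: (eqVneq y x) => [->|yx] /=.
  by case: eqP; case: (x \in s); case: (z \in s); case: (z \in m).
rewrite inE; case: (eqVneq z y) => [->|_] //=.
by rewrite yx.
Qed.

Lemma flips_expand s t x m : flips s t -> uniq s -> x \in s -> x \in m ->
    {in s, forall z, z \in m -> z = x} ->
    (forall i, noncrossing (expand x m s) (mem m) (F i)) ->
  exists2 m', m' = m \/ m' = rev m & flips (expand x m s) (expand x m' t).
Proof.
move=> fl; elim: fl m => {s t} [s|u v w t nv _ IH] m us xs xm fresh nm.
  by exists m; [left | apply: Flips0].
have pv : perm_eq (u ++ v ++ w) (u ++ rev v ++ w).
  by rewrite perm_cat2l perm_cat2r perm_sym perm_rev.
have step i : noncrossing (expand x m u ++ expand x m v ++ expand x m w)
    (mem (expand x m v)) (F i).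
  rewrite -!expand_cat; move: us xs fresh (nm i) (nv i).
  have : {subset v <= u ++ v ++ w} by move=> z zv; rewrite !mem_cat zv orbT.
  move: (u ++ v ++ w) => s vs us xs fresh nmi nvi.
  case: (boolP (x \in v)) => xv; last first.
    rewrite (expand_notin m xv); case: nvi => [vA|vA|Av].
    - by apply: Or31 => z; apply: vA.
    - by apply: Or32 => z; apply: vA.
    case: nmi => [mA|mA|Am].
    - by have := Av x xs (mA x xm); rewrite (_ : (x \in mem v) = false) //; apply/negbTE.
    - apply: Or33 => z; rewrite mem_expand xs /= => /orP[/andP[_ zs]|zm] zA; first exact: Av.
      by have := mA z zm; rewrite zA.
    - apply: Or32 => z zv; apply/negP => zA; have zs := vs z zv.
      have zx : z != x by apply: contraNneq xv => <-.
      have := Am z; rewrite mem_expand zs zx => /(_ isT zA) /(fresh z zs)/eqP.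
      by rewrite (negbTE zx).
  have memv z : z \in mem (expand x m v) = (z != x) && (z \in v) || (z \in m).
    by rewrite -[LHS]/(z \in expand x m v) mem_expand xv.
  have mems z : z \in expand x m s = (z != x) && (z \in s) || (z \in m).
    by rewrite mem_expand xs.
  case: nmi => [mA|mA|Am].
  - case: nvi => [vA|vA|Av].
    + by apply: Or31 => z; rewrite memv => /orP[/andP[_ /vA]|/mA].
    + by have := vA x xv; rewrite (mA x xm).
    + apply: Or33 => z; rewrite mems memv => /orP[/andP[-> zs] /(Av z zs) zv|->].
        by rewrite (_ : z \in v).
      by rewrite orbT.
  - case: nvi => [vA|vA|Av].
    + by have := mA x xm; rewrite (vA x xv).
    + by apply: Or32 => z; rewrite memv => /orP[/andP[_ /vA]|/mA].
    + apply: Or33 => z; rewrite mems memv => /orP[/andP[-> zs] /(Av z zs) zv|->].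
        by rewrite (_ : z \in v).
      by rewrite orbT.
  - by apply: Or33 => z zs /(Am z zs) zm; rewrite memv (_ : z \in m) // orbT.
have [m0 rm0 em0] : exists2 m0, m0 = m \/ m0 = rev m &
    expand x m u ++ rev (expand x m v) ++ expand x m w = expand x m0 (u ++ rev v ++ w).
  case: (boolP (x \in v)) => xv; [exists (rev m); first by right|exists m; first by left].
  - move: us; rewrite uniq_catCA cat_uniq => /and3P[_ /hasPn xuw _].
    have xu : x \notin u.
      by apply/negP => xu; have := xuw x; rewrite mem_cat xu => /(_ isT)/negP; apply.
    have xw : x \notin w.
      by apply/negP => xw; have := xuw x; rewrite mem_cat xw orbT => /(_ isT)/negP; apply.
    by rewrite !expand_cat !(expand_notin _ xu) !(expand_notin _ xw) expand_rev.
  - have xrv : x \notin rev v by rewrite mem_rev.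
    by rewrite !expand_cat (expand_notin m xv) (expand_notin m xrv).
have pm0 : perm_eq m m0 by case: rm0 => ->; rewrite // perm_sym perm_rev.
have [||||i|m' rm' fl] := IH m0.
- by rewrite -(perm_uniq pv).
- by rewrite -(perm_mem pv).
- by rewrite -(perm_mem pm0).
- by move=> z; rewrite -(perm_mem pv) -(perm_mem pm0); apply: fresh.
- have eqm : mem m =i mem m0 by move=> z; apply: perm_mem.
  have eqs z : z \in expand x m0 (u ++ rev v ++ w) = (z \in expand x m (u ++ v ++ w)).
    by rewrite !mem_expand -!(perm_mem pv) -(perm_mem pm0).
  case: (nm i) => [mA|mA|Am]; [apply: Or31|apply: Or32|apply: Or33] => z.
  + by rewrite -eqm; apply: mA.
  + by rewrite -eqm; apply: mA.
  + by rewrite eqs -eqm; apply: Am.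
exists m'; first by case: rm' => ->; case: rm0 => ->; rewrite ?revK; auto.
by rewrite !expand_cat; apply: FlipsS step _; rewrite em0.
Qed.

End Flips.

(** * Overlap components, their hulls and atoms *)

Section Overlap.
Variables (T I : finType) (F : I -> {set T}).
Implicit Types (r s t : seq T) (i j k : I) (x y z : T).

Definition overlap : rel I := fun i j =>
  [&& F i :&: F j != set0, ~~ (F i \subset F j) & ~~ (F j \subset F i)].

Definition convex_family r :=
  [/\ uniq r, forall i, convex r (F i) & forall i, {subset F i <= r}].

Lemma overlap_sym : symmetric overlap.
Proof. by move=> i j; rewrite /overlap setIC; congr (_ && _); rewrite andbC. Qed.

Lemma connect_overlap_sym : connect_sym overlap.
Proof. exact: sym_connect_sym overlap_sym. Qed.

Lemma overlapP i j : overlap i j -> exists x y z,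
  [/\ x \in F i /\ x \in F j, y \in F i /\ y \notin F j & z \in F j /\ z \notin F i].
Proof.
case/and3P => /set0Pn[x]; rewrite inE => /andP[xi xj] /subsetPn[y yi yj] /subsetPn[z zj zi].
by exists x, y, z.
Qed.

Lemma overlapPn i j : ~~ overlap i j ->
  [\/ F i \subset F j, F j \subset F i | {in F i, forall x, x \notin F j}].
Proof.
rewrite /overlap !negb_and !negbK => /or3P[/eqP ij|ij|ji]; last 2 first.
- exact: Or31.
- exact: Or32.
apply: Or33 => x xi; apply/negP => xj.
by have := in_set0 x; rewrite -ij inE xi xj.
Qed.

(** Consecutive members of an overlap path share a point, so a point outside the component keeps its
    side along the path. *)
Lemma connect_side r i j x x' y : convex_family r -> y \in r ->
  (forall k, connect overlap i k -> y \notin F k) -> connect overlap i j ->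
  x \in F i -> x' \in F j -> before r x y = before r x' y.
Proof.
move=> [ur cr Fr] yr yF /connectP[p]; elim: p i x yF => [|i1 p IH] i x yF /=.
  move=> _ -> xi x'i; apply: (convex_side ur (cr i)) (yF _ (connect0 _ _)) => //.
    exact: Fr xi.
  exact: Fr x'i.
case/andP=> ov pp lp xi x'j.
have [z [_ [_ [[zi zi1] _ _]]]] := overlapP ov.
rewrite (convex_side ur (cr i) (Fr _ _ xi) (Fr _ _ zi)) ?yF //.
apply: IH pp lp zi1 x'j => k /(connect_trans (connect1 ov)); exact: yF.
Qed.

Definition hull i := \bigcup_(k | connect overlap i k) F k.

Lemma hullP i x : reflect (exists2 k, connect overlap i k & x \in F k) (x \in hull i).
Proof. exact: (iffP bigcupP) => -[k]; exists k. Qed.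

Lemma convex_hull r i : convex_family r -> convex r (hull i).
Proof.
move=> cF x y z xy yz /hullP[k ik xk] /hullP[l il zl]; apply/negPn/negP => yU.
have [ur _ _] := cF.
have [/andP[xr yr] /andP[_ zr]] := (before_mem xy, before_mem yz).
have yz' : y != z by apply: contraNneq yU => ->; apply/hullP; exists l.
have := before_antisym ur yr zr yz'.
rewrite yz -(connect_side (i := k) (j := l) (x := x) (y := y) cF) ?xy //.
  move=> h kh; apply: contraNN yU => yh; apply/hullP; exists h => //.
  exact: connect_trans kh.
by apply: connect_trans il; rewrite connect_overlap_sym.
Qed.

(** The next set on the path meets [F j] but does not overlap it, and it cannot contain [F j]
    because it misses a point of the previous set. *)
Lemma connect_nested i j k : ~~ connect overlap i j -> F i \subset F j ->
  connect overlap i k -> F k \subset F j.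
Proof.
move=> + + /connectP[p]; elim: p i => [|i1 p IH] i nij ij /=; first by move=> _ ->.
case/andP=> ov pp lp; have [x [y [_ [[xi xi1] [yi yi1] _]]]] := overlapP ov.
have ni1j : ~~ connect overlap i1 j.
  by apply: contraNN nij; apply: connect_trans; apply: connect1.
apply: (IH i1 ni1j _ pp lp); have := contraNN (@connect1 _ _ _ _) ni1j.
case/overlapPn => // [ji1|dis].
  by have := subsetP ji1 y (subsetP ij y yi); rewrite (negbTE yi1).
by have := dis x xi1; rewrite (subsetP ij).
Qed.

(** A set outside the component overlaps no member: it contains one member and hence all of them, or
    lies inside one, or is disjoint from all. *)
Lemma noncrossing_hull s i j : noncrossing s (mem (hull i)) (F j).
Proof.
case: (boolP (connect overlap i j)) => [ij|nij].
  by apply: Or33 => x _ xj; apply/hullP; exists j.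
have nkj k : connect overlap i k -> ~~ connect overlap k j.
  by move=> ik; apply: contraNN nij; apply: connect_trans.
case: (pickP (fun k => connect overlap i k && (F k \subset F j))) => [k /andP[ik kj]|no1].
  apply: Or31 => x /hullP[h ih]; apply/subsetP.
  apply: (connect_nested (nkj k ik)) => //; apply: connect_trans ih.
  by rewrite connect_overlap_sym.
case: (pickP (fun k => connect overlap i k && (F j \subset F k))) => [k /andP[ik jk]|no2].
  by apply: Or33 => x _ xj; apply/hullP; exists k => //; apply: (subsetP jk).
apply: Or32 => x /hullP[k ik xk].
have := contraNN (@connect1 _ _ _ _) (nkj k ik); case/overlapPn.
- by move=> kj; have := no1 k; rewrite ik kj.
- by move=> jk; have := no2 k; rewrite ik jk.
- by apply.
Qed.

Section Spanning.
Variables (s : seq T) (i0 : I).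
Hypothesis span : {in s, forall x, x \in hull i0}.

(** The atoms are the classes of points that the overlap component of [i0] does not distinguish. *)
Definition atom x := [set z in s |
  [forall i, connect overlap i0 i ==> ((z \in F i) == (x \in F i))]].

Lemma atomP x z : reflect (z \in s /\
    forall i, connect overlap i0 i -> (z \in F i) = (x \in F i)) (z \in atom x).
Proof.
rewrite inE; apply: (iffP andP) => -[zs zx]; split=> //.
  by move=> i ii; apply/eqP/(implyP (forallP zx i)).
by apply/forallP => i; apply/implyP => /zx ->.
Qed.

(** A member with a point between [p] and [q] but missing both lies entirely between them. A member
    overlapping it cannot contain both ends, or it would swallow the first by convexity, so it lies
    there too. *)
Lemma atom_gap r i j p q y : convex_family r ->
  (forall k, connect overlap i0 k -> (p \in F k) = (q \in F k)) ->
  connect overlap i0 i -> connect overlap i j ->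
  y \in F i -> p \notin F i -> before r p y -> before r y q -> p \notin F j.
Proof.
move=> [ur cr Fr] pq i0i /connectP[l]; elim: l i y i0i => [|i1 l IH] i y i0i /=.
  by move=> _ ->.
case/andP=> ov pl el yi pi py yq.
have [/andP[pr yr] /andP[_ qr]] := (before_mem py, before_mem yq).
have [x [z [_ [[xi xi1] [zi zi1] _]]]] := overlapP ov.
have qi : q \notin F i by rewrite -pq.
have between w : w \in F i -> before r p w && before r w q.
  move=> wi; have wp : w != p by apply: contraNneq pi => <-.
  have wq : w != q by apply: contraNneq qi => <-.
  have yp : y != p by apply: contraNneq pi => <-.
  have yq' : y != q by apply: contraNneq qi => <-.
  have wr := Fr i w wi.
  rewrite (before_antisym ur wr pr wp) (convex_side (x' := y) ur (cr i)) //.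
  rewrite -(before_antisym ur yr pr yp) py /=.
  by rewrite (convex_side (x' := y) ur (cr i)).
have i0i1 := connect_trans i0i (connect1 ov).
case: (boolP (p \in F i1)) => pi1.
  have qi1 : q \in F i1 by rewrite -pq.
  have /andP[pz zq] := between z zi.
  by have := cr i1 p z q pz zq pi1 qi1; rewrite (negbTE zi1).
have /andP[px xq] := between x xi.
exact: IH i0i1 pl el xi1 pi1 px xq.
Qed.

Lemma convex_atom r x : convex_family r -> r =i s -> convex r (atom x).
Proof.
move=> cF rs p y q py yq /atomP[ps px] /atomP[qs qx]; have [ur cr Fr] := cF.
apply/atomP; split; first by rewrite -rs; case/andP: (before_mem py).
move=> i i0i; have [xi|xi] := boolP (x \in F i).
  by rewrite (cr i p y q) // ?px ?qx.
apply/negbTE/negP => yi; have /hullP[j i0j pj] := span ps.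
have /negP[] // : p \notin F j.
apply: (atom_gap cF _ i0i) py yq => //; last by rewrite px.
- by move=> k i0k; rewrite px // qx.
- by apply: connect_trans i0j; rewrite connect_overlap_sym.
Qed.

(** A set outside the component that meets the atom and also leaves it contains two points separated
    by some member. It then contains that member, and with it the whole hull. *)
Lemma noncrossing_atom x j : {subset F j <= s} -> noncrossing s (mem (atom x)) (F j).
Proof.
move=> Fjs; case: (boolP (connect overlap i0 j)) => i0j.
  have [xj|xj] := boolP (x \in F j); [apply: Or31|apply: Or32] => z /atomP[_ ->] //.
case: (pickP [pred z in F j | z \in atom x]) => /= [z /andP[zj zx]|dis]; last first.
  by apply: Or32 => z zx; apply/negP => zj; have := dis z; rewrite /= zj zx.
case: (boolP (F j \subset atom x)) => [sub|/subsetPn[a aj ax]].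
  by apply: Or33 => w _; apply: subsetP.
have [i i0i [b [c [bj cj bi ci]]]] : exists2 i, connect overlap i0 i &
    exists b c, [/\ b \in F j, c \in F j, b \in F i & c \notin F i].
  have /negP := ax; rewrite inE (Fjs a aj) /= => /negP/forallPn[i].
  rewrite negb_imply => /andP[i0i]; have [_ <-//] := atomP _ _ zx.
  move=> az; exists i => //; move: az.
  case: (boolP (a \in F i)) => ai; case: (boolP (z \in F i)) => zi // _.
    by exists a, z.
  by exists z, a.
have nij : ~~ connect overlap i j.
  by apply: contraNN i0j; apply: connect_trans.
have ij : F i \subset F j.
  case/overlapPn: (contraNN (@connect1 _ _ _ _) nij) => // [ji|/(_ b bi)].
    by have := subsetP ji c cj; rewrite (negbTE ci).
  by rewrite bj.
apply: Or31 => w /atomP[/span/hullP[k i0k wk] _]; apply: subsetP wk.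
apply: connect_nested nij ij _.
by apply: connect_trans i0k; rewrite connect_overlap_sym.
Qed.

End Spanning.

End Overlap.

(** * An overlap component determines the order up to reversal *)

Section Rigid.
Variables (T I : finType) (F : I -> {set T}) (s t : seq T).
Implicit Types (i j k : I) (x y z : T) (c d : bool).
Hypotheses (st : perm_eq s t) (cs : convex_family F s) (ct : convex_family F t).

Let same x y := before s x y == before t x y.
Let us : uniq s. Proof. by case: cs. Qed.
Let ut : uniq t. Proof. by case: ct. Qed.
Let Fs i x : x \in F i -> x \in s. Proof. by case: cs => _ _; apply. Qed.
Let Ft i x : x \in F i -> x \in t. Proof. by case: ct => _ _; apply. Qed.

Let sameC x y : x \in s -> y \in s -> x != y -> same x y = same y x.
Proof.
move=> xs ys xy; rewrite /same (before_antisym us ys xs) 1?eq_sym //.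
rewrite (before_antisym ut _ _ _ : before t x y = ~~ before t y x) -?(perm_mem st) 1?eq_sym //.
by case: before; case: before.
Qed.

Let same_side i x x' y : x \in F i -> x' \in F i -> y \in s -> y \notin F i ->
  same x y = same x' y.
Proof.
move=> xi x'i ys yi; have [[_ cvs _] [_ cvt _]] := (cs, ct).
rewrite /same (convex_side us (cvs i) (Fs xi) (Fs x'i)) //.
by rewrite (convex_side ut (cvt i) (Ft xi) (Ft x'i)) // -(perm_mem st).
Qed.

Let neq_mem i x y : x \in F i -> y \notin F i -> x != y.
Proof. by move=> xi; apply: contraNneq => <-. Qed.

(** The last premise leaves out the pairs with both points in both sets, on which these two sets
    impose nothing. *)
Let agree i j c := forall x y, x \in F i -> y \in F j ->
  (y \notin F i) || (x \notin F j) -> same x y = c.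

Let agree_sym i j c : agree i j c -> agree j i c.
Proof.
move=> ij x y xj yi nxy; rewrite sameC ?(Fs xj) ?(Fs yi) //.
  by apply: ij; rewrite // orbC.
by case/orP: nxy => [/(neq_mem xj)|/(neq_mem yi)//]; rewrite eq_sym.
Qed.

(** By [same_side], every such pair can be moved to one fixed pair [w], [v] taken from the two
    differences. *)
Let overlap_agree i j : overlap F i j -> exists c, agree i j c.
Proof.
case/overlapP=> p [w [v [[pi pj] [wi wj] [vj vi]]]]; exists (same w v) => x y xi yj.
case/orP => [yi|xj].
  rewrite (same_side xi wi (Fs yj) yi) sameC ?(Fs wi) ?(Fs yj) ?(neq_mem wi) //.
  rewrite (same_side yj vj (Fs wi) wj) sameC ?(Fs wi) ?(Fs vj) //.
  by rewrite (neq_mem vj).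
rewrite sameC ?(Fs xi) ?(Fs yj) //; last by rewrite eq_sym (neq_mem yj).
rewrite (same_side yj vj (Fs xi) xj) sameC ?(Fs xi) ?(Fs vj) ?(neq_mem vj) //.
exact: same_side xi wi (Fs vj) vi.
Qed.

(* The traces of [F i] and [F k] on [F j] are proper and nonempty: either they *)
(* meet without covering [F j], or neither contains the other.                *)
Let agree_trans i j k c d : overlap F i j -> overlap F j k ->
  agree i j c -> agree j k d -> c = d.
Proof.
move=> /overlapP[p [_ [q [[pi pj] _ [qj qi]]]]] /overlapP[r [u [_ [[rj rk] [uj uk] _]]]].
move=> ij jk.
have meet a b : a \in F i -> a \in F j -> a \in F k ->
    b \in F j -> b \notin F i -> b \notin F k -> c = d.
  move=> ai aj ak bj bi bk; rewrite -(ij a b) ?bi //.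
  by rewrite sameC ?(Fs ai) ?(Fs bj) ?(neq_mem ai) // (jk b a) ?bk ?orbT.
have cross a b : a \in F i -> a \in F j -> a \notin F k ->
    b \in F j -> b \notin F i -> b \in F k -> c = d.
  by move=> ai aj ak bj bi bk; rewrite -(ij a b) ?bi // (jk a b) ?ak ?orbT.
have [pk|pk] := boolP (p \in F k); have [qk|qk] := boolP (q \in F k).
- have [ui|ui] := boolP (u \in F i); first exact: (cross u q).
  exact: (meet p u).
- exact: (meet p q).
- exact: (cross p q).
- have [ri|ri] := boolP (r \in F i); first exact: (meet r q).
  exact: (cross p r).
Qed.

Variables (i0 j0 : I).
Hypothesis ov0 : overlap F i0 j0.

Let agree_connect c i : agree i0 j0 c -> connect (overlap F) i0 i ->
  forall j, overlap F i j -> agree i j c.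
Proof.
move=> a0 /connectP[p pp ->]; have : forall j, overlap F i0 j -> agree i0 j c.
  move=> j ij; have [d ad] := overlap_agree ij.
  by rewrite (agree_trans _ ij (agree_sym a0) ad) // overlap_sym.
elim: p {a0} i0 pp => //= i1 p IH i2 /andP[ov pp] a2.
apply: IH pp _ => j ij; have [d ad] := overlap_agree ij.
by rewrite (agree_trans ov ij (a2 _ ov) ad).
Qed.

(** Follow an overlap path towards a member containing [y], replacing [x] by a common point of
    consecutive members, until the next member contains [y]. *)
Let same_separated c i x y : agree i0 j0 c -> connect (overlap F) i0 i ->
  x \in F i -> y \notin F i -> y \in hull F i0 -> same x y = c.
Proof.
move=> a0 i0i xi yi /hullP[j i0j yj].
have /connectP[p] : connect (overlap F) i j.
  by apply: connect_trans i0j; rewrite connect_overlap_sym.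
elim: p i x xi yi i0i => [|i1 p IH] i x xi yi i0i /=.
  by move=> _ ij; move: yj; rewrite ij (negbTE yi).
case/andP=> ov pp jl; have [yi1|yi1] := boolP (y \in F i1).
  by apply: (agree_connect a0 i0i ov); rewrite ?yi.
have [z [_ [_ [[zi zi1] _ _]]]] := overlapP ov.
rewrite (same_side xi zi (Fs yj) yi).
exact: IH zi1 yi1 (connect_trans i0i (connect1 ov)) pp jl.
Qed.

Hypothesis span : {in s, forall x, x \in hull F i0}.
Hypothesis separated : {in s &, forall x y, x != y ->
  exists2 i, connect (overlap F) i0 i & (x \in F i) != (y \in F i)}.

Lemma order_rigid : s = t \/ s = rev t.
Proof.
have [c a0] := overlap_agree ov0.
have eqc x y : x \in s -> y \in s -> x != y -> same x y = c.
  move=> xs ys xy; have [i i0i] := separated xs ys xy.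
  case: (boolP (x \in F i)) => xi; case: (boolP (y \in F i)) => yi //= _.
    exact: same_separated xi yi (span ys).
  by rewrite sameC //; apply: same_separated yi xi (span xs).
case: c {a0} eqc => eqc; [left|right]; apply: eq_before => //.
- by move=> x y xs ys xy; apply/eqP/eqc.
- by rewrite rev_uniq.
- by rewrite perm_sym perm_rev perm_sym.
move=> x y xs ys xy; rewrite before_rev.
rewrite (before_antisym ut) -?(perm_mem st) //.
by have := eqc x y xs ys xy; rewrite /same; case: before; case: before.
Qed.

End Rigid.

(** * Orders with common intervals are joined by reversals *)

Section Connectivity.
Variables (T I : finType).
Implicit Types (F : I -> {set T}) (s t u v w m : seq T).

Lemma flips_sub F F' s t : (forall i, F' i = F i :&: [set x in s]) ->
  flips F' s t -> flips F s t.
Proof.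
move=> eF fl; have ss : {subset s <= s} by [].
have {eF} : forall i x, x \in s -> (x \in F' i) = (x \in F i).
  by move=> i x xs; rewrite eF !inE xs andbT.
elim: fl {ss} => {s t} [s|u v w t nc _ IH] eF; first exact: Flips0.
apply: FlipsS => [i|].
  have vs x : x \in v -> x \in u ++ v ++ w by move=> xv; rewrite !mem_cat xv orbT.
  case: (nc i) => [vA|vA|Av]; [apply: Or31|apply: Or32|apply: Or33].
  - by move=> x xv; rewrite -eF ?vs //; apply: vA.
  - by move=> x xv; rewrite -eF ?vs //; apply: vA.
  - by move=> x xs; rewrite -eF //; apply: Av.
by apply: IH => i x xs; apply: eF; move: xs; rewrite !mem_cat mem_rev.
Qed.

(** If some sets overlap, the hull of their component must be everything and its atoms must be
    single points, so [order_rigid] applies. Otherwise each set is itself noncrossing, hence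
    everything or at most a point, and no set restricts reversals. *)
Lemma flips_prime F s t : perm_eq s t -> convex_family F s -> convex_family F t ->
  (forall M : {set T}, {subset M <= s} -> convex s M -> convex t M ->
     (forall i, noncrossing s (mem M) (F i)) -> 1 < #|M| -> {subset s <= M}) ->
  flips F s t.
Proof.
move=> st cs ct prime; have [us cvs Fs] := cs; have [_ cvt _] := ct.
case: (pickP (fun ij => overlap F ij.1 ij.2)) => /= [[i0 j0] /= ov0|nov].
  have [p [w [v [[pi pj] [wi wj] [vj vi]]]]] := overlapP ov0.
  have subhull i : connect (overlap F) i0 i -> {subset F i <= hull F i0}.
    by move=> ii x xi; apply/hullP; exists i.
  have span : {subset s <= hull F i0}.
    apply: prime => [x /hullP[i _]||||]; first exact: Fs.
    - exact: convex_hull.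
    - exact: convex_hull.
    - by move=> i; apply: noncrossing_hull.
    - apply/card_gt1P; exists p, w; split; first exact: (subhull i0).
        exact: (subhull i0).
      by apply: contraNneq wj => <-.
  have separated : {in s &, forall x y, x != y ->
      exists2 i, connect (overlap F) i0 i & (x \in F i) != (y \in F i)}.
    move=> x y xs ys xy.
    case: (pickP (fun i => connect (overlap F) i0 i && ((x \in F i) != (y \in F i)))).
      by move=> i /andP[]; exists i.
    move=> nsep; have ax z : (z \in atom F s i0 x) -> z \in s by case/atomP.
    have sub : {subset s <= atom F s i0 x}.
      apply: prime => //.
      - exact: convex_atom.
      - by apply: convex_atom => // z; rewrite (perm_mem st).
      - by move=> i; apply: noncrossing_atom => //; apply: Fs.
      - apply/card_gt1P; exists x, y; split=> //; apply/atomP; split=> // i ii.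
        by apply/esym/eqP; have := nsep i; rewrite ii /= => /negbFE.
    have /atomP[_ /(_ i0 (connect0 _ _))] := sub w (Fs _ _ wi).
    have /atomP[_ /(_ i0 (connect0 _ _))] := sub v (Fs _ _ vj).
    by rewrite wi (negbTE vi) => <-.
  by case: (order_rigid st cs ct ov0 span separated) => ->; [exact: Flips0|];
     rewrite -[t in flips _ _ t]revK; apply: flips_rev.
have {}nov i j : ~~ overlap F i j by have := nov (i, j) => /= ->.
have small i : {subset s <= F i} \/ #|F i| <= 1.
  case: (leqP #|F i| 1) => [le1|big]; [by right|left].
  apply: (prime _ _ _ _ _ big) => // j.
  case: (overlapPn (nov i j)) => [/subsetP|ji|]; [exact: Or31| |exact: Or32].
  by apply: Or33 => x _; apply: (subsetP ji).
apply: flips_free st => v vs i; case: (small i) => [sF|/card_le1P sF].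
  by apply: Or31 => x /vs/sF.
case: (pickP [pred x in F i | x \in v]) => /= [x /andP[xi xv]|dis].
  by apply: Or33 => y _; rewrite (sF x xi) inE => /eqP->.
by apply: Or32 => x xv; apply/negP => xi; have := dis x; rewrite /= xi [x \in v]xv.
Qed.

(** Contract the block [M] to a point [z], join the contracted orders, expand, and then rearrange
    the block in place. Both orders to be joined are shorter than [s]. *)
Lemma flips_split F s t (M : {set T}) (x : T) :
  (forall s' t', size s' < size s -> uniq s' -> perm_eq s' t' ->
     (forall i, convex s' (F i)) -> (forall i, convex t' (F i)) -> flips F s' t') ->
  uniq s -> perm_eq s t ->
  (forall i, convex s (F i)) -> (forall i, convex t (F i)) ->
  {subset M <= s} -> convex s M -> convex t M ->
  (forall i, noncrossing s (mem M) (F i)) -> 1 < #|M| -> x \in s -> x \notin M ->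
  flips F s t.
Proof.
move=> IH us st cs ct Ms cM tM nM M1 xs xM.
have ut : uniq t by rewrite -(perm_uniq st).
have [u [m [w [es mM Mm mN]]]] := convex_split us cM.
have [u' [m' [w' [et mM' Mm' mN']]]] := convex_split ut tM.
have memm y : (y \in m) = (y \in M).
  by apply/idP/idP => [/mM//|yM]; apply: Mm => //; apply: Ms.
have memm' y : (y \in m') = (y \in M).
  apply/idP/idP => [/mM'//|yM]; apply: Mm' => //; rewrite -(perm_mem st).
  exact: Ms.
have um : uniq m by move: us; rewrite es uniq_catCA cat_uniq => /andP[].
have um' : uniq m' by move: ut; rewrite et uniq_catCA cat_uniq => /andP[].
have pm : perm_eq m m' by apply: uniq_perm => // y; rewrite memm memm'.
have szm : 1 < size m by rewrite -(card_uniqP um) (eq_card memm).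
have [z zm] : exists z, z \in m by case: (m) szm => // z m0; exists z; rewrite mem_head.
have zm' : z \in m' by rewrite -(perm_mem pm).
have zuw := mN z zm; have zuw' := mN' z zm'.
have ez r : z \notin u ++ w -> expand z r (u ++ z :: w) = u ++ r ++ w.
  rewrite mem_cat negb_or => /andP[zu zw].
  by rewrite -cat1s !expand_cat expand_one !expand_notin.
have ez' r : expand z r (u' ++ z :: w') = u' ++ r ++ w'.
  move: zuw'; rewrite mem_cat negb_or => /andP[zu zw].
  by rewrite -cat1s !expand_cat expand_one !expand_notin.
have subs : subseq (u ++ z :: w) s.
  rewrite es -[z :: w]cat1s; apply: cat_subseq => //; apply: cat_subseq => //.
  by rewrite sub1seq.
have subt : subseq (u' ++ z :: w') t.
  rewrite et -[z :: w']cat1s; apply: cat_subseq => //; apply: cat_subseq => //.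
  by rewrite sub1seq.
have us' : uniq (u ++ z :: w) := subseq_uniq subs us.
have pq : perm_eq (u ++ z :: w) (u' ++ z :: w').
  have catCz a b : perm_eql (a ++ z :: b) (z :: a ++ b).
    by rewrite -cat1s; apply: perm_catCA.
  rewrite catCz (permPr (permEl (catCz u' w'))) perm_cons -(perm_cat2l m).
  apply: (@perm_trans _ (m' ++ u' ++ w')); last by rewrite perm_cat2r perm_sym.
  by rewrite perm_catCA -es (permPl st) et perm_catCA.
have flq : flips F (u ++ z :: w) (u' ++ z :: w').
  apply: IH => // [|i|i].
  - by rewrite es !size_cat ltn_add2l /= -[(size w).+1]add1n ltn_add2r.
  - exact: convex_subseq (cs i).
  - exact: convex_subseq (ct i).
have nm i : noncrossing s (mem m) (F i).
  case: (nM i) => [vA|vA|Av]; [apply: Or31|apply: Or32|apply: Or33].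
  - by move=> y; rewrite (memm y : _ = _); apply: vA.
  - by move=> y; rewrite (memm y : _ = _); apply: vA.
  - by move=> y ys yF; rewrite (memm y : _ = _); apply: Av.
have [||||i|m0 em0] := flips_expand (x := z) (m := m) flq.
- by [].
- by rewrite mem_cat mem_head orbT.
- by [].
- move=> y; rewrite mem_cat inE orbCA -mem_cat => /predU1P[//|yuw] /mN.
  by rewrite yuw.
- by rewrite ez // -es.
rewrite ez // ez' -es => fl0.
have pm0 : perm_eq m m0 by case: em0 => ->; rewrite // perm_sym perm_rev.
apply: flips_trans fl0 _.
have pm0m' : perm_eq m0 m' by rewrite -(permPl pm0).
have pst0 : perm_eq s (u' ++ m0 ++ w').
  by rewrite (permPl st) et perm_cat2l perm_cat2r perm_sym.
rewrite et; apply: flips_ctx => [i|].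
  case: (nM i) => [vA|vA|Av]; [apply: Or31|apply: Or32|apply: Or33].
  - by move=> y; rewrite -[_ \in _](perm_mem pm0) memm; apply: vA.
  - by move=> y; rewrite -[_ \in _](perm_mem pm0) memm; apply: vA.
  - move=> y; rewrite -(perm_mem pst0) => ys yF.
    by rewrite -[_ \in _](perm_mem pm0) memm; apply: Av.
apply: IH => // [|||i].
- rewrite -(perm_size pm0) -(card_uniqP um).
  have -> : size s = #|s| by rewrite (card_uniqP us).
  apply: proper_card; apply/properP; split.
    by apply/subsetP => y; rewrite memm => /Ms.
  by exists x => //; rewrite memm.
- by rewrite -(perm_uniq pm0).
- have ms : subseq m s.
    by rewrite es; apply: subseq_trans (suffix_subseq _ _); apply: prefix_subseq.
  case: em0 => -> i; last apply: convex_rev; exact: convex_subseq (cs i).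
- apply: convex_subseq (ct i); rewrite et.
  by apply: subseq_trans (suffix_subseq _ _); apply: prefix_subseq.
Qed.

(* These moves are the transformations of Booth and Lueker's PQ-trees.       *)
Lemma flips_connected F s t : uniq s -> perm_eq s t ->
  (forall i, convex s (F i)) -> (forall i, convex t (F i)) -> flips F s t.
Proof.
have [k] := ubnP (size s); elim: k s t => // k IH s t sk us st cs ct.
have ut : uniq t by rewrite -(perm_uniq st).
(* Either a proper block with at least two elements can be contracted, or the situation is prime. *)
have [[M [x [cM tM nM M1 Ms]]]|noM] := EM (exists (M : {set T}) x,
    [/\ convex s M, convex t M, forall i, noncrossing s (mem M) (F i), 1 < #|M|
      & [/\ {subset M <= s}, x \in s & x \notin M]]).
  case: Ms => Ms xs xM.
  apply: (flips_split _ us st cs ct Ms cM tM nM M1 xs xM) => s' t' ss'.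
  by apply: IH; apply: leq_trans ss' _.
apply: (@flips_sub F (fun i => F i :&: [set x in s])) => //.
have st' : [set x in t] = [set x in s] by apply/setP => x; rewrite !inE (perm_mem st).
apply: flips_prime => // [||M Ms cM tM nM M1 x xs].
- by split=> // i; [apply: convexI | move=> x; rewrite !inE => /andP[]].
- split=> // i; first by rewrite -st'; apply: convexI.
  by move=> x; rewrite -st' !inE => /andP[].
apply/negPn/negP => xM; apply: noM; exists M, x; split=> // i.
case: (nM i) => [vA|vA|Av]; [apply: Or31|apply: Or32|apply: Or33].
- by move=> y /vA; rewrite inE => /andP[].
- by move=> y yM; have := vA y yM; rewrite !inE Ms // andbT.
- by move=> y ys yF; apply: Av => //; rewrite !inE yF.
Qed.

End Connectivity.

(** * Pattern cones *)

Section Signed.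
Variables (R : numDomainType) (n : nat).
Local Open Scope ring_scope.

(* The step from value [a] to value [b] as the vector [eps * 1_S], with [S] and  *)
(* [eps] its level set and its sign; see [signedE] and [signed_mapP].         *)
Definition signed (a b k : nat) : R := (k < b)%:R - (k < a)%:R.

Lemma signedE (a b k : nat) :
  signed a b k = (Num.sg (b%:Z - a%:Z))%:~R *+ (minn a b <= k < maxn a b).
Proof.
rewrite /signed; case: (ltngtP a b) => [ab|ba|->].
- rewrite gtr0_sg ?subr_gt0 ?ltz_nat //.
  case: (leqP a k) => ak; case: (ltnP k b) => kb; rewrite /= ?subr0 ?subrr //.
  all: try by exfalso; lia.
- rewrite ltr0_sg ?subr_lt0 ?ltz_nat // mulrNz.
  case: (leqP b k) => bk; case: (ltnP k a) => ka; rewrite /= ?sub0r ?subrr //.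
  all: try by exfalso; lia.
  all: try by rewrite ?sub0r ?oppr0.
- by rewrite !subrr sgr0 mul0rn.
Qed.

Lemma signed_eq0 (a b k : nat) : a != b ->
  (signed a b k == 0) = ~~ (minn a b <= k < maxn a b)%N.
Proof.
move=> ab; rewrite signedE; case: (_ <= _ < _)%N => /=; last by rewrite eqxx.
by rewrite mulr1n intr_eq0 sgr_eq0 subr_eq0 eqz_nat eq_sym (negbTE ab).
Qed.

Lemma signed_mapP (f : 'S_n) (a b a' b' : 'I_n.+1) : a != b -> a' != b' ->
  (f @: level_set n (minn a b) (maxn a b), Num.sg (b%:Z - a%:Z)) =
    (level_set n (minn a' b') (maxn a' b'), Num.sg (b'%:Z - a'%:Z)) <->
  forall k : 'I_n, signed a b k = signed a' b' (f k).
Proof.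
move=> ab ab'; split=> [[eS es] k|eq].
  rewrite !signedE es; congr (_ *+ nat_of_bool _).
  have := mem_imset (level_set n (minn a b) (maxn a b)) k (@perm_inj _ f).
  by rewrite eS !inE.
have eS (k : 'I_n) : (minn a b <= k < maxn a b)%N = (minn a' b' <= f k < maxn a' b')%N.
  by apply: negb_inj; rewrite -!signed_eq0 // eq.
congr (_, _).
  apply/setP => k; rewrite -[k](permKV f) mem_imset ?inE ?eS //.
  exact: perm_inj.
have kP : (minn a b < n)%N.
  by have := ltn_ord a; have := ltn_ord b; move: ab; rewrite -val_eqE /=; lia.
have := eq (Ordinal kP); rewrite !signedE -eS /=.
have -> : (minn a b <= minn a b < maxn a b)%N by move: ab; rewrite -val_eqE /=; lia.
by rewrite /= !mulr1n => /intr_inj.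
Qed.

Lemma sum_gaps (f : 'I_n.+1 -> R) (b : 'I_n.+1) :
  \sum_(k < n) (k < b)%:R * (f (lift ord0 k) - f (widen_ord (leqnSn n) k)) =
  f b - f ord0.
Proof.
pose g i := f (inord i).
transitivity (\sum_(k < n | (k < b)%N) (g k.+1 - g k)).
  rewrite [RHS]big_mkcond; apply: eq_bigr => k _.
  rewrite /g; have -> : inord k.+1 = lift ord0 k :> 'I_n.+1.
    by apply: val_inj; rewrite /= inordK // ltnS.
  have -> : inord k = widen_ord (leqnSn n) k :> 'I_n.+1.
    by apply: val_inj; rewrite /= inordK // ltnW // ltnS.
  by case: ifP; rewrite ?mul1r ?mul0r.
have bn : (b <= n)%N by rewrite -ltnS.
rewrite -(big_ord_widen n (fun k => g k.+1 - g k) bn).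
rewrite -(big_mkord xpredT (fun k => g k.+1 - g k)) telescope_sumr //.
by congr (f _ - f _); apply: val_inj; rewrite /= inordK.
Qed.

Lemma sum_signed_gaps (f : 'I_n.+1 -> R) (a b : 'I_n.+1) :
  \sum_(k < n) signed a b k * (f (lift ord0 k) - f (widen_ord (leqnSn n) k)) =
  f b - f a.
Proof.
under eq_bigr do rewrite mulrBl.
by rewrite big_split sumrN /= !sum_gaps; ring.
Qed.

(** The height of value [b] above the lowest value of a walk with gaps [y]. *)
Definition height (y : 'I_n -> R) (b : nat) : R := \sum_(k < n) (k < b)%:R * y k.

Lemma sum_signed (y : 'I_n -> R) (a b : nat) :
  \sum_(k < n) signed a b k * y k = height y b - height y a.
Proof. by rewrite -sumrB; apply: eq_bigr => k _; rewrite mulrBl. Qed.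

Lemma height_gap y (k : 'I_n) : height y k.+1 - height y k = y k.
Proof.
rewrite -sumrB (bigD1 k) //= ltnSn ltnn mul1r mul0r subr0 big1 ?addr0 // => j jk.
have -> : (j < k.+1)%N = (j < k)%N.
  by rewrite ltnS ltn_neqAle; move: jk; rewrite -val_eqE => ->.
by rewrite subrr.
Qed.

End Signed.

(** * Nonnegative matrices with nonnegative inverse *)

Section NonnegInverse.
Local Open Scope ring_scope.

(** The sums giving the entries of [A *m B] cannot cancel, so nonzero [A i j] and [B j k] force
    [i = k]; likewise for [B *m A]. Each row of [A] then has exactly one nonzero entry. *)
Lemma nonneg_inverse_perm (R : realFieldType) (n : nat) (A B : 'M[R]_n) :
  (forall i j, 0 <= A i j) -> (forall i j, 0 <= B i j) ->
  A *m B = 1%:M -> B *m A = 1%:M ->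
  exists s : 'S_n, forall i j, (A i j != 0) = (j == s i).
Proof.
move=> A0 B0 AB BA.
have diag (C D : 'M[R]_n) : (forall i j, 0 <= C i j) -> (forall i j, 0 <= D i j) ->
    C *m D = 1%:M -> (forall i j k, C i j != 0 -> D j k != 0 -> i = k) /\
    (forall i, exists2 j, C i j != 0 & D j i != 0).
  move=> C0 D0 CD; split=> [i j k Cij Djk|i].
    have /matrixP/(_ i k) := CD; rewrite !mxE; case: eqVneq => // _ /= eq0.
    have /eqP := @psumr_eq0P _ _ _ _ (fun l _ => mulr_ge0 (C0 i l) (D0 l k)) eq0 j isT.
    by rewrite mulf_eq0 (negbTE Cij) (negbTE Djk).
  have /matrixP/(_ i i) := CD; rewrite !mxE eqxx /=.
  case: (pickP (fun j => (C i j != 0) && (D j i != 0))) => [j /andP[]|none]; first by exists j.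
  rewrite big1 => [/esym/eqP|j _]; first by rewrite oner_eq0.
  by have /= := none j; case: eqP => [->|_ /negbFE/eqP->]; rewrite ?mul0r ?mulr0.
have [ABd ABx] := diag A B A0 B0 AB; have [BAd BAx] := diag B A B0 A0 BA.
have nzB i j : A i j != 0 -> B j i != 0.
  by move=> Aij; have [k Bjk _] := BAx j; rewrite (ABd i j k).
have {}ABx i : exists j, A i j != 0 by have [j] := ABx i; exists j.
have [f fP] := fin_all_exists ABx.
have uniqf i j : A i j != 0 -> j = f i by move=> Aij; apply: (BAd j i (f i)) => //; apply: nzB.
have finj : injective f.
  by move=> i i' eqf; apply: (ABd i (f i)) => //; rewrite eqf; apply: nzB.
exists (perm finj) => i j; rewrite permE.
by apply/idP/eqP => [/uniqf|->].
Qed.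

End NonnegInverse.

Lemma card_lt_ord (n c : nat) : (c <= n)%N -> #|[set j : 'I_n | (j < c)%N]| = c.
Proof.
by move=> cn; rewrite -sum1dep_card -(big_ord_widen n (fun=> 1%N) cn) sum1_card card_ord.
Qed.

(** * The cone of walks with a given pattern *)

Section Cone.
Variables (R : realType) (n : nat).
Local Open Scope ring_scope.
Implicit Types (x y : 'rV[R]_n) (pi tau : 'S_n.+1).

(** Column [m] is the signed indicator of step [m], so multiplying a row of gaps by this matrix
    gives the row of increments. *)
Definition step_mx pi : 'M[R]_n :=
  \matrix_(k, m) signed R (step_src pi m) (step_dst pi m) k.

Lemma step_srcK pi m : (pi^-1)%g (step_src pi m) = widen_ord (leqnSn n) m.
Proof. exact: permK. Qed.

Lemma step_dstK pi m : (pi^-1)%g (step_dst pi m) = lift ord0 m.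
Proof. exact: permK. Qed.

Lemma mul_step_mx y pi m :
  (y *m step_mx pi) 0 m = height (y 0) (step_dst pi m) - height (y 0) (step_src pi m).
Proof. by rewrite -sum_signed mxE; apply: eq_bigr => k _; rewrite mxE mulrC. Qed.

Lemma partial_sum_height x i : partial_sum x i = height (x 0) i.
Proof.
rewrite /partial_sum big_mkcond; apply: eq_bigr => k _.
by case: ifP; rewrite ?mul1r ?mul0r.
Qed.

Lemma partial_sum_gap x m :
  partial_sum x (lift ord0 m) - partial_sum x (widen_ord (leqnSn n) m) = x 0 m.
Proof. by rewrite !partial_sum_height height_gap. Qed.

Lemma partial_sum_step_mx y pi i :
  partial_sum (y *m step_mx pi) i = height (y 0) (pi i) - height (y 0) (pi ord0).
Proof.
rewrite partial_sum_height -[RHS](sum_gaps (fun j => height (y 0) (pi j))).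
by apply: eq_bigr => k _; rewrite mul_step_mx.
Qed.

Definition gaps pi x : 'rV[R]_n :=
  \row_k (partial_sum x ((pi^-1)%g (lift ord0 k)) -
          partial_sum x ((pi^-1)%g (widen_ord (leqnSn n) k))).

Lemma gapsK pi x : gaps pi x *m step_mx pi = x.
Proof.
have hg (b : 'I_n.+1) : height (gaps pi x 0) b =
    partial_sum x ((pi^-1)%g b) - partial_sum x ((pi^-1)%g ord0).
  rewrite -(sum_gaps (fun j => partial_sum x ((pi^-1)%g j))).
  by apply: eq_bigr => k _; rewrite mxE.
apply/rowP => m; rewrite mul_step_mx !hg step_srcK step_dstK.
by rewrite opprB addrA subrK partial_sum_gap.
Qed.

(** [gapsK] holds for every [x], whatever its pattern, so every unit vector is attained. *)
Lemma step_mx_unit pi : step_mx pi \in unitmx.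
Proof.
have : (\matrix_i gaps pi (row i 1%:M)) *m step_mx pi = 1%:M.
  by apply/row_matrixP => i; rewrite row_mul rowK gapsK.
by case/mulmx1_unit.
Qed.

Lemma height_lt y (a b : nat) : (forall k, 0 < y 0 k) -> (b <= n)%N -> (a < b)%N ->
  height (y 0) a < height (y 0) b.
Proof.
move=> y0 bn ab; rewrite -subr_gt0 -sum_signed (bigD1 (Ordinal (leq_trans ab bn))) //=.
rewrite /signed ab ltnn subr0 mul1r ltr_pwDl // sumr_ge0 // => k _.
apply: mulr_ge0; last exact: ltW.
rewrite subr_ge0 ler_nat.
by case: (ltnP k a) => // ka; rewrite (ltn_trans ka ab).
Qed.

Lemma has_patternP x pi :
  has_pattern x pi <-> exists2 y : 'rV[R]_n, forall k, 0 < y 0 k & x = y *m step_mx pi.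
Proof.
split=> [[_ xpi]|[y y0 ->]].
  exists (gaps pi x); last by rewrite gapsK.
  move=> k; rewrite mxE subr_gt0 ltNge; apply/negP => le.
  have : (pi ((pi^-1)%g (lift ord0 k)) <= pi ((pi^-1)%g (widen_ord (leqnSn n) k)))%N.
    rewrite -ltnS !xpi; apply/subset_leq_card/subsetP => j; rewrite !inE => /le_trans; exact.
  by rewrite !permKV /= ltnn.
have leP i j : (partial_sum (y *m step_mx pi) i <= partial_sum (y *m step_mx pi) j) =
    (pi i <= pi j)%N.
  rewrite !partial_sum_step_mx lerD2r.
  case: (ltngtP (pi i) (pi j)) => [ij|ji|->]; last by rewrite lexx.
    by rewrite ltW // height_lt // -ltnS.
  by apply/negbTE; rewrite -ltNge height_lt // -ltnS.
split=> [i j eqij|i].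
  apply: (@perm_inj _ pi); apply: val_inj; apply/eqP.
  by rewrite eqn_leq -!leP eqij lexx.
rewrite -[LHS](card_lt_ord (ltn_ord (pi i))) -(card_preimset _ (@perm_inj _ pi)).
by apply: eq_card => j; rewrite !inE leP ltnS.
Qed.

Lemma signed_norm (a b k : nat) : signed R a b k != 0 -> `|signed R a b k| = 1.
Proof.
rewrite /signed; case: (k < a)%N; case: (k < b)%N; rewrite ?subrr ?eqxx // ?subr0 ?sub0r.
  by rewrite normrN normr1.
by rewrite normr1.
Qed.

Lemma row_step_mx_neq0 pi k : exists m, step_mx pi k m != 0.
Proof.
case: (pickP (fun m => step_mx pi k m != 0)) => [m|none]; first by exists m.
have /eqP : delta_mx 0 k *m step_mx pi = 0 :> 'rV[R]_n.
  by apply/rowP => m; rewrite -rowE !mxE; have /negbFE/eqP := none m; rewrite mxE.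
rewrite -[X in _ == X](mul0mx _ (step_mx pi)).
rewrite (inj_eq (can_inj (mulmxK (step_mx_unit pi)))) => /eqP/rowP/(_ k).
by rewrite !mxE !eqxx => /eqP; rewrite oner_eq0.
Qed.

Lemma pattern_equiv_step_mx pi tau (rho s : 'S_n) :
  (forall k m, step_mx pi k (rho m) = step_mx tau (s k) m) -> pattern_equiv R pi tau.
Proof.
move=> eqL; exists rho => x.
have mul y : col_perm rho (y *m step_mx pi) = col_perm s^-1 y *m step_mx tau.
  apply/rowP => m; rewrite !mxE [RHS](reindex_inj (@perm_inj _ s)) /=.
  by apply: eq_bigr => k _; rewrite [in RHS]mxE permK eqL.
split=> /has_patternP[y y0 ex]; apply/has_patternP.
  by exists (col_perm s^-1 y) => [k|]; rewrite ?ex ?mul // mxE.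
exists (col_perm s y) => [k|]; first by rewrite mxE.
have {}ex : col_perm rho x = col_perm rho (col_perm s y *m step_mx pi).
  by rewrite ex mul -col_permM mulVg col_perm1.
apply/rowP => m; have /rowP/(_ ((rho^-1)%g m)) := ex.
by rewrite !mxE permKV.
Qed.

(* The linear map carrying the cone of [pi] to that of [tau] preserves the    *)
(* positive orthant of gap vectors, and so does its inverse.                  *)
Lemma step_mx_pattern_equiv pi tau : pattern_equiv R pi tau ->
  exists rho s : 'S_n, forall k m, step_mx pi k (rho m) = step_mx tau (s k) m.
Proof.
case=> rho equ; pose P : 'M[R]_n := perm_mx rho^-1.
have Pu : P \in unitmx by apply: unitmx_perm.
have [Lu Mu] := (step_mx_unit pi, step_mx_unit tau).
pose A := step_mx pi *m P *m invmx (step_mx tau).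
have colP x : col_perm rho x = x *m P by rewrite col_permE.
have Au : A \in unitmx by rewrite !unitmx_mul Lu Pu unitmx_inv.
have posA y : (forall k, 0 < y 0 k) -> forall k, 0 < (y *m A) 0 k.
  move=> y0; have /equ : has_pattern (y *m step_mx pi) pi by apply/has_patternP; exists y.
  rewrite colP => /has_patternP[z z0 eyz] k.
  by rewrite /A !mulmxA eyz mulmxK.
have posB y : (forall k, 0 < y 0 k) -> forall k, 0 < (y *m invmx A) 0 k.
  move=> y0; have : has_pattern (col_perm rho (y *m step_mx tau *m invmx P)) tau.
    by rewrite colP mulmxKV //; apply/has_patternP; exists y.
  move/equ => /has_patternP[z z0 eyz] k.
  suff -> : y = z *m A by rewrite mulmxK.
  by rewrite /A !mulmxA -eyz mulmxKV // mulmxK.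
have nonneg (C : 'M[R]_n) : (forall y, (forall k, 0 < y 0 k) -> forall k, 0 < (y *m C) 0 k) ->
    forall i j, 0 <= C i j.
  move=> posC i j; rewrite leNgt; apply/negP => Cneg.
  pose one : 'rV[R]_n := const_mx 1.
  have one0 : 0 < (one *m C) 0 j by apply: posC => k; rewrite mxE.
  (* Chosen so that the positive vector [c *: one + delta_mx 0 i] has image with vanishing
     coordinate [j]. *)
  pose c := - C i j / (one *m C) 0 j.
  have c0 : 0 < c by rewrite divr_gt0 // oppr_gt0.
  suff : 0 < ((c *: one + delta_mx 0 i) *m C) 0 j.
    rewrite mulmxDl -scalemxAl -rowE [X in 0 < X]mxE [X in 0 < X + _]mxE.
    by rewrite [X in 0 < _ + X]mxE divfK ?gt_eqF // addNr ltxx.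
  apply: posC => k; rewrite !mxE mulr1; apply: ltr_wpDr => //; exact: ler0n.
have [s sP] :=
  nonneg_inverse_perm (nonneg _ posA) (nonneg _ posB) (mulmxV Au) (mulVmx Au).
exists rho, s => k m.
have eqA m' : step_mx pi k (rho m') = A k (s k) * step_mx tau (s k) m'.
  have : (A *m step_mx tau) k m' = col_perm rho (step_mx pi) k m'.
    by rewrite /A mulmxKV // col_permE.
  rewrite [RHS]mxE => <-; rewrite mxE (bigD1 (s k)) //= big1 ?addr0 // => j jk.
  by have := sP k j; rewrite (negbTE jk) => /negbFE/eqP ->; rewrite mul0r.
have [m' Lm'] := row_step_mx_neq0 tau (s k).
have Ask : A k (s k) != 0 by rewrite sP.
(* The nonzero entries of both step matrices have absolute value 1, hence so has this nonnegative
   factor. *)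
suff A1 : A k (s k) = 1 by rewrite eqA A1 mul1r.
have Lpi : step_mx pi k (rho m') != 0 by rewrite eqA mulf_neq0.
have := congr1 Num.norm (eqA m'); move: Lpi Lm'; rewrite ![step_mx _ _ _]mxE => Lpi Lm'.
rewrite normrM !signed_norm // mulr1 => ->.
by rewrite ger0_norm // (nonneg _ posA).
Qed.

End Cone.

(** * Intermediate permutations *)

Section Path.
Variables (n : nat) (a b : 'I_n -> 'I_n.+1) (p q : 'I_n.+1).
Hypothesis n0 : 0 < n.
(** The digraph with edges from [a m] to [b m] is connected, and its degrees are balanced as for a
    path from [p] to [q]. *)
Hypothesis conn : forall O : {set 'I_n.+1},
  (forall m, (a m \in O) = (b m \in O)) -> O = set0 \/ O = setT.
Hypothesis degree : forall v,
  #|[set m | a m == v]| + (v == q) = #|[set m | b m == v]| + (v == p).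

Let not_isolated v : (#|[set m | a m == v]| != 0) || (#|[set m | b m == v]| != 0).
Proof.
rewrite -negb_and; apply/negP; rewrite !cards_eq0 => /andP[/eqP/setP av /eqP/setP bv].
have [m||] := @conn [set v].
- by have := av m; have := bv m; rewrite !inE => -> ->.
- by move/setP/(_ v); rewrite !inE eqxx.
move=> vT; have := cardsT 'I_n.+1; rewrite -vT cards1 card_ord => -[] n1.
by have := n0; rewrite -n1.
Qed.

Let inj_image (f : 'I_n -> 'I_n.+1) r :
  (forall v, v != r -> exists m, f m = v) -> injective f /\ forall m, f m != r.
Proof.
move=> sur; have sub : [set~ r] \subset f @: setT.
  by apply/subsetP => v; rewrite !inE => /sur[m <-]; apply: imset_f.
have cr : #|[set~ r]| = n by rewrite cardsC1 card_ord.
have le : #|f @: setT| <= n by rewrite -[X in _ <= X]card_ord -cardsT leq_imset_card.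
have eqr : [set~ r] = f @: setT by apply/eqP; rewrite eqEcard sub cr.
split=> [m m'|m].
  have /imset_injP inj : #|f @: setT| == #|[set: 'I_n]| by rewrite -eqr cr cardsT card_ord.
  exact: inj (in_setT _) (in_setT _).
have : f m \in [set~ r] by rewrite eqr imset_f.
by rewrite !inE.
Qed.

Let a_props : injective a /\ forall m, a m != q.
Proof.
apply: inj_image => v vq; have := not_isolated v; have := degree v; rewrite (negbTE vq) addn0.
move=> dv nz; have : #|[set m | a m == v]| != 0 by case/orP: nz => //; lia.
by rewrite cards_eq0 => /set0Pn[m]; rewrite inE => /eqP; exists m.
Qed.

Let b_props : injective b /\ forall m, b m != p.
Proof.
apply: inj_image => v vp; have := not_isolated v; have := degree v; rewrite (negbTE vp) addn0.
move=> dv nz; have : #|[set m | b m == v]| != 0 by case/orP: nz => //; lia.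
by rewrite cards_eq0 => /set0Pn[m]; rewrite inE => /eqP; exists m.
Qed.

(** The default [p] is taken only at [q], the one vertex without outgoing edge. *)
Let next v := if [pick m | a m == v] is Some m then b m else p.

Let next_a m : next (a m) = b m.
Proof.
rewrite /next; case: pickP => [m' /eqP|/(_ m)]; last by rewrite eqxx.
by have [ia _] := a_props; move/ia->.
Qed.

Let next_inj : injective next.
Proof.
have [ib bp] := b_props; have [ia aq] := a_props.
have aim v : v != q -> exists m, a m = v.
  move=> vq; have := subset_leqif_cards (_ : a @: setT \subset [set~ q]).
  rewrite cardsC1 card_imset // cardsT !card_ord /= => H.
  have /eqP eqa : a @: setT == [set~ q].
    rewrite -H ?eqxx //; apply/subsetP => _ /imsetP[m _ ->]; by rewrite !inE.
  have /imsetP[m _ ->] : v \in a @: setT by rewrite eqa !inE.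
  by exists m.
have nq : next q = p.
  by rewrite /next; case: pickP => // m; rewrite (negbTE (aq m)).
move=> v v'; have [->|/aim[m <-]] := eqVneq v q; have [->|/aim[m' <-]] := eqVneq v' q => //.
- by rewrite nq next_a => /esym/eqP; rewrite (negbTE (bp m')).
- by rewrite nq next_a => /eqP; rewrite (negbTE (bp m)).
- by rewrite !next_a => /ib ->.
Qed.

(* Joining the end q back to p makes the edges a permutation; it is a single  *)
(* cycle, since each of its orbits is closed under the edges.                 *)
Lemma path_of_degrees : exists tau : 'S_n.+1,
  forall m, exists i, step_src tau i = a m /\ step_dst tau i = b m.
Proof.
have [_ bp] := b_props; pose s := perm next_inj.
have [m||sT] := @conn (porbit s p).
- rewrite porbit_sym [RHS]porbit_sym -next_a -[next _](permE next_inj) -/s.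
  by rewrite -(porbit_perm s 1) expg1.
- by move/setP/(_ p); rewrite porbit_id inE.
have cs : #|porbit s p| = n.+1 by rewrite sT cardsT card_ord.
have inj : injective (fun i : 'I_n.+1 => iter i s p).
  move=> i j eqi; have := uniq_traject_porbit s p; rewrite cs => un.
  apply/val_inj/eqP; rewrite /= -(nth_uniq p _ _ un) ?size_traject ?ltn_ord //.
  by rewrite (nth_traject _ (ltn_ord i)) (nth_traject _ (ltn_ord j)) eqi.
exists (perm inj) => m; set j := ((perm inj)^-1)%g (a m).
have ej : iter j s p = a m by rewrite -(permE inj) permKV.
have jn : j < n.
  have := ltn_ord j; rewrite ltnS leq_eqVlt => /predU1P[jn|//].
  have ejn : iter n s p = a m by rewrite -ej jn.
  have := iter_porbit s p; rewrite cs iterS ejn permE next_a => /eqP.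
  by rewrite (negbTE (bp m)).
exists (Ordinal jn); rewrite /step_src /step_dst !permE; split; first by rewrite -ej.
by rewrite -next_a -[next _](permE next_inj) -/s -ej.
Qed.

End Path.

(** * Level isomorphisms *)

Section Isomorphism.
Variables (R : realType) (n : nat).
Implicit Types (pi tau : 'S_n.+1) (s rho : 'S_n).
Local Open Scope ring_scope.

Local Notation sgn := (signed R).

Definition level_iso s pi tau := exists rho : 'S_n,
  forall k m, step_mx R pi k m = step_mx R tau (s k) (rho m).

Lemma step_src_neq pi m : step_src pi m != step_dst pi m.
Proof. by rewrite (inj_eq perm_inj) -val_eqE /= neq_ltn ltnSn. Qed.

Lemma step_src_inj pi : injective (step_src pi).
Proof. by move=> m m' /perm_inj/(congr1 val) eqm; apply: val_inj. Qed.

(** Pairing the vector with the gaps of an indicator function of a value recovers the two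
    endpoints. *)
Lemma signed_inj (a b a' b' : 'I_n.+1) : a != b ->
  (forall k : 'I_n, sgn a b k = sgn a' b' k) -> a = a' /\ b = b'.
Proof.
move=> ab eqs; have dif (f : 'I_n.+1 -> R) : f b - f a = f b' - f a'.
  by rewrite -!sum_signed_gaps; apply: eq_bigr => k _; rewrite eqs.
split; apply/esym/eqP.
  have := dif (fun v => (v == a)%:R); rewrite eqxx eq_sym (negbTE ab) /=.
  by case: (b' == a); case: (a' == a) => //= eqn; exfalso; lra.
have := dif (fun v => (v == b)%:R); rewrite eqxx (negbTE ab) /=.
by case: (b' == b); case: (a' == b) => //= eqn; exfalso; lra.
Qed.

Lemma level_iso_intro s pi tau :
  (forall m, exists m', forall k : 'I_n,
     sgn (step_src pi m) (step_dst pi m) k = sgn (step_src tau m') (step_dst tau m') (s k)) ->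
  level_iso s pi tau.
Proof.
case/fin_all_exists => f fP; have finj : injective f.
  move=> m m' eqf; apply: (@step_src_inj pi).
  have [|k|e _] // := @signed_inj (step_src pi m) (step_dst pi m)
    (step_src pi m') (step_dst pi m').
    exact: step_src_neq.
  by rewrite !fP eqf.
by exists (perm finj) => k m; rewrite !mxE permE fP.
Qed.

Lemma level_iso_trans s s' pi tau om :
  level_iso s pi tau -> level_iso s' tau om -> level_iso (s * s')%g pi om.
Proof.
move=> [rho e] [rho' e']; exists (rho * rho')%g => k m.
by rewrite !permM e e'.
Qed.

Lemma level_iso_pattern_equiv s pi tau : level_iso s pi tau -> pattern_equiv R pi tau.
Proof.
case=> rho e; apply: (@pattern_equiv_step_mx R n pi tau rho^-1 s) => k m.
by rewrite e permKV.
Qed.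

Lemma pattern_equiv_level_iso pi tau : pattern_equiv R pi tau -> exists s, level_iso s pi tau.
Proof.
case/step_mx_pattern_equiv => rho [s e]; exists s, rho^-1%g => k m.
by rewrite -e permKV.
Qed.

Lemma sum_step_mx pi k : \sum_m step_mx R pi k m = sgn (pi ord0) (pi ord_max) k.
Proof.
have := sum_gaps (fun i : 'I_n.+1 => (k < pi i)%:R : R) ord_max.
rewrite -/(sgn (pi ord0) (pi ord_max) k) => <-.
by apply: eq_bigr => m _; rewrite mxE /= ltn_ord mul1r.
Qed.

(** The steps add up to the signed interval between the endpoints, so its transport comes for
    free. *)
Lemma level_iso_ends s pi tau : level_iso s pi tau ->
  forall k : 'I_n, sgn (pi ord0) (pi ord_max) k = sgn (tau ord0) (tau ord_max) (s k).
Proof.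
case=> rho e k; rewrite -!sum_step_mx [RHS](reindex_inj (@perm_inj _ rho)) /=.
by apply: eq_bigr => m _.
Qed.

Lemma level_iso1 pi tau : level_iso 1%g pi tau -> pi = tau.
Proof.
case=> rho e.
have st m : step_src pi m = step_src tau (rho m) /\ step_dst pi m = step_dst tau (rho m).
  apply: signed_inj (step_src_neq _ _) _ => k.
  by have := e k m; rewrite !mxE perm1.
(* The first value of a permutation is the only one that is the target of no step. *)
have eq0 : pi ord0 = tau ord0.
  have [j ej] : exists j, tau j = pi ord0 by exists ((tau^-1)%g (pi ord0)); rewrite permKV.
  case: (unliftP ord0 j) ej => [m ->|-> //] ej.
  have [m' em'] : exists m', rho m' = m by exists ((rho^-1)%g m); rewrite permKV.
  by have [_] := st m'; rewrite em' /step_dst ej => /perm_inj/eqP; rewrite -val_eqE.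
apply/permP => -[i ilt]; elim: i ilt => [|i IH] ilt.
  by have -> : Ordinal ilt = ord0 by apply: val_inj.
have im : (i < n)%N by [].
have [es ed] := st (Ordinal im).
have ew : widen_ord (leqnSn n) (Ordinal im) = Ordinal (ltnW ilt) by apply: val_inj.
have rm : rho (Ordinal im) = Ordinal im.
  by apply: (@step_src_inj tau); rewrite -es /step_src ew IH.
have -> : Ordinal ilt = lift ord0 (Ordinal im) by apply: val_inj; rewrite /= /bump.
by move: ed; rewrite rm.
Qed.

Hypothesis n0 : (0 < n)%N.

(** Any signed intervals that correspond under [s] to the steps of [pi] form a path: connectedness
    is inherited from the invertibility of [step_mx], the degrees from the sum of the steps. *)
Lemma level_iso_realize s pi (a b : 'I_n -> 'I_n.+1) (p q : 'I_n.+1) :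
  (forall m (k : 'I_n), sgn (step_src pi m) (step_dst pi m) k = sgn (a m) (b m) (s k)) ->
  (forall k : 'I_n, sgn (pi ord0) (pi ord_max) k = sgn p q (s k)) ->
  exists tau, level_iso s pi tau.
Proof.
move=> edges ends.
have sum_edge (f : 'I_n.+1 -> R) (x y : 'I_n.+1) : f y - f x =
    \sum_k sgn x y (s k) * (f (lift ord0 (s k)) - f (widen_ord (leqnSn n) (s k))).
  by rewrite -(sum_signed_gaps f x y) (reindex_inj (@perm_inj _ s)).
have [|v|tau tauP] := @path_of_degrees n a b p q n0.
(* The indicator of [O] is constant along every edge, so its gap vector is killed by an invertible
   matrix. *)
- move=> O Oab; pose f v : R := (v \in O)%:R.
  pose g : 'rV[R]_n := \row_k (f (lift ord0 (s k)) - f (widen_ord (leqnSn n) (s k))).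
  have : g *m step_mx R pi == 0 *m step_mx R pi.
    apply/eqP/rowP => m; rewrite mul0mx [RHS]mxE.
    transitivity (f (b m) - f (a m)); last by rewrite /f Oab subrr.
    rewrite sum_edge mxE; apply: eq_bigr => k _.
    by rewrite mxE [step_mx _ _ _ _]mxE edges mulrC.
  rewrite (inj_eq (can_inj (mulmxK (step_mx_unit R pi)))) => /eqP g0.
  have const v : f v = f ord0.
    apply/eqP; rewrite -subr_eq0 sum_edge big1 // => k _.
    by have /rowP/(_ k) := g0; rewrite !mxE => ->; rewrite mulr0.
  case: (boolP (ord0 \in O)) => O0; [right|left]; apply/setP => v; have := const v.
    by rewrite /f O0 inE; case: (v \in O) => // /esym/eqP; rewrite oner_eq0.
  by rewrite /f (negbTE O0) inE; case: (v \in O) => // /eqP; rewrite oner_eq0.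
(* Pairing the sum of all edges with the indicator of [v] gives in-degree minus out-degree. *)
- have deg : \sum_m ((b m == v)%:R - (a m == v)%:R) = (q == v)%:R - (p == v)%:R :> R.
    rewrite (sum_edge (fun x => (x == v)%:R)).
    under eq_bigr do rewrite (sum_edge (fun x => (x == v)%:R)).
    rewrite exchange_big; apply: eq_bigr => k _; rewrite -ends -sum_step_mx mulr_suml.
    by apply: eq_bigr => m _; rewrite mxE edges.
  move/eqP: deg; rewrite sumrB -!natr_sum.
  have count_eq (c : 'I_n -> 'I_n.+1) : #|[set m | c m == v]| = (\sum_m (c m == v))%N.
    by rewrite -sum1dep_card big_mkcond.
  rewrite subr_eq addrAC eq_sym subr_eq -!natrD eqr_nat => /eqP eqn.
  by rewrite !count_eq [v == q]eq_sym [v == p]eq_sym addnC eqn.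
exists tau; apply: level_iso_intro => m; have [i [ei ei']] := tauP m.
by exists i => k; rewrite edges ei ei'.
Qed.

End Isomorphism.

(** * The action of a flip on intervals and positions *)

Lemma laminarC n (A B : {set 'I_n}) : laminar A B = laminar B A.
Proof. by rewrite /laminar setIC orbCA. Qed.

Lemma val_flip n (i j : 'I_n.+1) (k : 'I_n) :
  flip i j k = (if i <= k < j then i + j - 1 - k else k) :> nat.
Proof. by rewrite permE val_flip_fun. Qed.

(** An interval inside the flipped one has its endpoints reflected, and exchanged to keep the sign.
    In the other two cases no endpoint lies strictly between [i] and [j], and nothing changes. *)
Lemma laminar_flip (R : numDomainType) n (i j x y : 'I_n.+1) : i < j -> x != y ->
  laminar (level_set n (minn x y) (maxn x y)) (level_set n i j) ->
  exists x' y' : 'I_n.+1, forall k : 'I_n,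
    signed R x y k = signed R x' y' (flip i j k).
Proof.
move=> ij xy lam; have {}xy : x != y :> nat by [].
have [jn [xn yn]] := (ltn_ord j, (ltn_ord x, ltn_ord y)).
have fixed : (x <= i \/ j <= x) -> (y <= i \/ j <= y) ->
    exists x' y' : 'I_n.+1, forall k : 'I_n,
      signed R x y k = signed R x' y' (flip i j k).
  move=> xo yo; exists x, y => k; rewrite /signed !val_flip.
  have -> : (k < y) = ((if i <= k < j then i + j - 1 - k else k) < y).
    by clear -yo ij; case: ifP; lia.
  have -> // : (k < x) = ((if i <= k < j then i + j - 1 - k else k) < x).
  by clear -xo ij; case: ifP; lia.
have minP : minn x y < n by clear -xy xn yn; lia.
have maxP : (maxn x y).-1 < n by clear -xy xn yn; lia.
have iP : i < n by clear -ij jn; lia.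
have jP : j.-1 < n by clear -ij jn; lia.
case/or3P: lam => [/subsetP sub|/subsetP sub|/eqP/setP dis].
- have := sub (Ordinal minP); have := sub (Ordinal maxP); rewrite !inE /= => h1 h2.
  have [xi xj] : i <= x /\ x <= j by clear -h1 h2 xy; lia.
  have [yi yj] : i <= y /\ y <= j by clear -h1 h2 xy; lia.
  have x'n : i + j - y < n.+1 by clear -yi yj xn jn; lia.
  have y'n : i + j - x < n.+1 by clear -xi xj yn jn; lia.
  exists (Ordinal x'n), (Ordinal y'n) => k; rewrite /signed val_flip /=.
  case: (boolP (i <= k < j)) => kij.
    have -> : (i + j - 1 - k < i + j - x) = ~~ (k < x) by clear -kij xi xj; lia.
    have -> : (i + j - 1 - k < i + j - y) = ~~ (k < y) by clear -kij yi yj; lia.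
    by case: (k < x); case: (k < y); rewrite /= ?subrr ?subr0 ?sub0r.
  have -> : (k < i + j - x) = (k < y) by clear -kij xi xj yi yj; lia.
  by have -> : (k < i + j - y) = (k < x) by clear -kij xi xj yi yj; lia.
- have := sub (Ordinal iP); have := sub (Ordinal jP); rewrite !inE /= => h1 h2.
  by apply: fixed; clear -h1 h2 ij; lia.
- have := dis (Ordinal iP); have := dis (Ordinal minP); rewrite !inE /= => h1 h2.
  by apply: fixed; clear -h1 h2 ij xy; lia.
Qed.

Lemma index_flip (T : eqType) (u v w : seq T) x : uniq (u ++ v ++ w) -> x \in u ++ v ++ w ->
  index x (u ++ rev v ++ w) =
    if size u <= index x (u ++ v ++ w) < size u + size v
    then size u + (size u + size v) - 1 - index x (u ++ v ++ w)
    else index x (u ++ v ++ w).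
Proof.
rewrite !cat_uniq => /and3P[_ nu /and3P[uv _ _]] _; rewrite !index_cat !size_rev mem_rev.
case: (boolP (x \in u)) => xu.
  by rewrite -index_mem in xu; rewrite leqNgt xu.
case: (boolP (x \in v)) => xv; last by rewrite ifF //; lia.
rewrite leq_addr ltn_add2l index_mem xv /=.
have ix : index x v < size v by rewrite index_mem.
have -> : index x (rev v) = size v - (index x v).+1; last by lia.
rewrite -[in LHS](nth_index x xv) -[nth x v _](_ : nth x (rev v) (size v - (index x v).+1) = _).
  by rewrite index_uniq ?rev_uniq // size_rev; lia.
by rewrite nth_rev; [congr nth|]; lia.
Qed.

Section Connected.
Variable n : nat.
Implicit Types pi tau : 'S_n.+1.

Lemma flip_connected_refl pi : flip_connected pi pi.
Proof. by exists 0, (fun=> pi); split. Qed.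

Lemma flip_connected_step pi tau om :
  flip_step pi tau -> flip_connected tau om -> flip_connected pi om.
Proof.
move=> st [l [s [s0 sl ss]]]; exists l.+1, (fun r => if r is r'.+1 then s r' else pi).
by split=> // -[_|r]; [rewrite s0 | apply: ss].
Qed.

Lemma flip_connected_ind (P : 'S_n.+1 -> Prop) tau : P tau ->
  (forall pi om, flip_step pi om -> P om -> P pi) ->
  forall pi, flip_connected pi tau -> P pi.
Proof.
move=> Pt Ps pi [l [s [<- sl ss]]]; rewrite -sl in Pt.
elim: l s ss Pt {sl} => // l IH s ss Pt; apply: (Ps _ (s 1)); first exact: ss.
by apply: (IH (fun r => s r.+1)) => // r rl; apply: ss.
Qed.

End Connected.

(** * Reversals of level orders as valid flips *)

Section Main.
Variables (R : realType) (n : nat).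
Hypothesis n0 : (0 < n).
Implicit Types (pi tau : 'S_n.+1) (s : 'S_n).

Lemma level_iso_edge s pi tau (rho : 'S_n) m :
  (forall k m, step_mx R pi k m = step_mx R tau (s k) (rho m)) ->
  (s @: step_set pi m, step_sign pi m) = (step_set tau (rho m), step_sign tau (rho m)).
Proof.
move=> e; apply/(signed_mapP R); rewrite ?step_src_neq // => k.
by have := e k m; rewrite !mxE.
Qed.

Lemma level_isoP s pi tau : level_iso R s pi tau <->
  forall m, exists m', (s @: step_set pi m, step_sign pi m) = (step_set tau m', step_sign tau m').
Proof.
split=> [[rho e] m|e].
  by exists (rho m); apply: level_iso_edge.
apply: level_iso_intro => m; have [m'] := e m; exists m'.
by apply/(signed_mapP R); rewrite ?step_src_neq.
Qed.

Lemma flip_step_level_iso pi tau : flip_step pi tau -> exists s, level_iso R s pi tau.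
Proof.
case=> i [j [_ eqs]]; exists (flip i j); apply/level_isoP => m.
have : (flip i j @: step_set pi m, step_sign pi m) \in
    [seq (step_set tau m, step_sign tau m) | m : 'I_n].
  by rewrite -eqs; apply/imageP; exists m.
by case/imageP => m' _; exists m'.
Qed.

Lemma level_iso_flip_step pi tau (i j : 'I_n.+1) :
  valid_flip pi i j -> level_iso R (flip i j) pi tau -> flip_step pi tau.
Proof.
move=> val iso; exists i, j; split=> // -[A e]; case: iso => rho iso.
have eqm m := level_iso_edge m iso.
apply/imageP/imageP => -[m _ ->]; first by exists (rho m); rewrite ?eqm.
by exists ((rho^-1)%g m); rewrite ?eqm ?permKV.
Qed.

Lemma valid_flip_realize pi (i j : 'I_n.+1) : valid_flip pi i j ->
  exists tau, level_iso R (flip i j) pi tau.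
Proof.
case=> ij ends edges.
have edge m : exists ab : 'I_n.+1 * 'I_n.+1, forall k : 'I_n,
    signed R (step_src pi m) (step_dst pi m) k = signed R ab.1 ab.2 (flip i j k).
  have [a [b abP]] := @laminar_flip R n i j _ _ ij (step_src_neq pi m) (edges m).
  by exists (a, b).
have [ab abP] := fin_all_exists edge.
have end_neq : pi ord0 != pi ord_max by rewrite (inj_eq perm_inj) -val_eqE /= neq_ltn n0.
rewrite laminarC in ends.
have [p [q pqP]] := @laminar_flip R n i j _ _ ij end_neq ends.
exact: (@level_iso_realize R n n0 (flip i j) pi (fun m => (ab m).1)
                           (fun m => (ab m).2) p q).
Qed.

(** [None] adds the endpoint interval, so that one noncrossing condition covers both clauses of
    [valid_flip]. *)
Definition level_family pi (o : option 'I_n) : {set 'I_n} :=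
  if o is Some m then step_set pi m
  else level_set n (minn (pi ord0) (pi ord_max)) (maxn (pi ord0) (pi ord_max)).

Lemma level_iso_family s pi tau : level_iso R s pi tau ->
  exists rho : 'S_n, forall o, s @: level_family pi o = level_family tau (omap rho o).
Proof.
move=> iso; have ends := level_iso_ends iso; case: iso => rho e; exists rho => -[m|] /=.
  by have [] := level_iso_edge m e.
have neq (om : 'S_n.+1) : om ord0 != om ord_max.
  by rewrite (inj_eq perm_inj) -val_eqE /= neq_ltn n0.
by have /(signed_mapP R s (neq pi) (neq tau)) [] := ends.
Qed.

(** The sequence [r] lists the levels of [pi0] by their position [s k] in the current permutation. A
    segment of [r] thus becomes a level interval there, and its reversal composes [s] with a
    flip. *)
Lemma flips_flip_connected (pi0 : 'S_n.+1) (r t : seq 'I_n) (s : 'S_n) pi :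
  flips (level_family pi0) r t -> uniq r -> (forall k, k \in r) ->
  (forall k, index k r = s k) -> level_iso R s pi0 pi ->
  exists s' tau, [/\ forall k, index k t = s' k, level_iso R s' pi0 tau
    & flip_connected pi tau].
Proof.
move=> fl; elim: fl s pi => {r t} [r|u v w t nc _ IH] s pi ur allr idx iso.
  by exists s, pi; split=> //; apply: flip_connected_refl.
have szr : size (u ++ v ++ w) = n.
  rewrite -(card_uniqP ur) -[RHS]card_ord; apply: eq_card => k.
  by rewrite allr.
(* Reversing an empty segment is no flip, since a flip needs [i < j]. *)
have [v0|v0] := posnP (size v).
  by have {}v0 := size0nil v0; subst v; apply: IH ur allr idx iso.
have perm_r : perm_eq (u ++ v ++ w) (u ++ rev v ++ w).
  by rewrite perm_cat2l perm_cat2r perm_sym perm_rev.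
have iP : size u < n.+1 by have := leq_addr (size (v ++ w)) (size u); rewrite -size_cat szr.
have jP : size u + size v < n.+1.
  by have := leq_addr (size w) (size (u ++ v)); rewrite -size_cat -catA szr size_cat.
pose i := Ordinal iP; pose j := Ordinal jP.
have vP k : (k \in v) = (s k \in level_set n i j).
  rewrite inE /= -idx !index_cat; move: ur; rewrite uniq_catCA cat_uniq => /and3P[_ hv _].
  have [ku|ku] := boolP (k \in u).
    have kv : k \notin v.
      by apply: contraNN hv => kv; apply/hasP; exists k; rewrite // mem_cat ku.
    by rewrite (negbTE kv) leqNgt index_mem ku.
  have [kv|kv] := boolP (k \in v).
    by rewrite leq_addr ltn_add2l index_mem kv.
  by rewrite leq_addr ltn_add2l ltnNge leq_addr.
have eB : level_set n i j = [set s k | k in v].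
  apply/setP => k; rewrite -[k](permKV s) -vP mem_imset //; exact: perm_inj.
have lam o : laminar (s @: level_family pi0 o) (level_set n i j).
  rewrite eB; apply/or3P; case: (nc o) => [vA|vA|Av].
  - by apply: Or32; apply: imsetS; apply/subsetP.
  - apply: Or33; apply/eqP/setP => k; rewrite -[k](permKV s) !inE !(mem_imset _ _ perm_inj).
    by apply/negP => /andP[kA kv]; have := vA _ kv; rewrite kA.
  - apply: Or31; apply: imsetS; apply/subsetP => k kA; exact: Av.
have [rho fam] := level_iso_family iso.
have val : valid_flip pi i j.
  split; first by rewrite /= -addn1 leq_add2l.
    rewrite laminarC.
    by have := lam None; rewrite fam.
  by move=> m; have := lam (Some ((rho^-1)%g m)); rewrite fam /= permKV.
have [tau isot] := valid_flip_realize val.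
have [||||s' [om [idx' iso' con]]] := IH (s * flip i j)%g tau.
- by rewrite -(perm_uniq perm_r).
- by move=> k; rewrite -(perm_mem perm_r).
- by move=> k; rewrite permM index_flip // val_flip -!idx.
- exact: level_iso_trans iso isot.
exists s', om; split=> //; apply: flip_connected_step con.
exact: level_iso_flip_step isot.
Qed.

Lemma convex_level_set (r : seq 'I_n) s (A : {set 'I_n}) (x y : nat) : uniq r ->
  (forall k, index k r = s k) -> s @: A = level_set n x y -> convex r A.
Proof.
move=> ur idx sA k l m; rewrite !before_index // !idx.
move=> /and3P[_ _ kl] /and3P[_ _ lm].
have memA j : (j \in A) = (s j \in level_set n x y).
  by rewrite -sA mem_imset //; apply: perm_inj.
rewrite !memA !inE => /andP[xk _] /andP[_ my].
by rewrite (leq_trans xk (ltnW kl)) (ltn_trans lm my).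
Qed.

End Main.

Theorem theorem3p3 (R : realType) (n : nat) (hn : (2 <= n.+1)%N)
    (pi tau : 'S_n.+1) :
  pattern_equiv R pi tau <-> flip_connected pi tau.
Proof.
split=> [/pattern_equiv_level_iso[s iso]|]; last first.
  apply: (@flip_connected_ind n (fun om => pattern_equiv R om tau)).
    by exists 1%g => x; rewrite col_perm1.
  move=> {}pi om /(@flip_step_level_iso R n)[s /level_iso_pattern_equiv[rho e1]] [rho' e2].
  exists (rho' * rho)%g => x; apply: iff_trans (e1 x) _.
  by rewrite col_permM; apply: e2.
(* The order [t] puts level [k] at position [s k]. *)
pose r := enum 'I_n; pose t := [seq (s^-1)%g k | k <- r].
have ur : uniq r by apply: enum_uniq.
have allr k : k \in r by rewrite mem_enum.
have idxr k : index k r = (1%g : 'S_n) k by rewrite perm1 index_enum_ord.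
have ut : uniq t by rewrite map_inj_uniq //; apply: perm_inj.
have idxt k : index k t = s k.
  by rewrite -[k in LHS](permK s) index_map ?index_enum_ord //; apply: perm_inj.
have iso1 : level_iso R 1%g pi pi.
  by exists 1%g => k m; rewrite !perm1.
have [rho fam] := level_iso_family hn iso.
have famE om o : exists x y, level_family om o = level_set n x y.
  by case: o => [m|]; [exists (minn (step_src om m) (step_dst om m)),
    (maxn (step_src om m) (step_dst om m)) |
    exists (minn (om ord0) (om ord_max)), (maxn (om ord0) (om ord_max))].
have rt : perm_eq r t.
  apply: uniq_perm => // k; rewrite allr; apply/esym/mapP; exists (s k); rewrite ?permK //.
have fl : flips (level_family pi) r t.
  apply: flips_connected => // o.
    have [x [y e]] := famE pi o.
    apply: (convex_level_set (x := x) (y := y) ur idxr); rewrite -e.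
    by apply/setP => k; rewrite -{1}[k](perm1) (mem_imset _ _ (@perm_inj _ 1%g)).
  have [x [y e]] := famE tau (omap rho o).
  by apply: (convex_level_set (x := x) (y := y) ut idxt); rewrite fam.
have [s' [om [idx' iso' con]]] := flips_flip_connected hn fl ur allr idxr iso1.
have es : s' = s by apply/permP => k; apply: val_inj; rewrite /= -idx' idxt.
suff <- : om = tau by [].
(* Both [om] and [tau] are images of [pi] under the same [s], so the identity of the levels is an
   isomorphism between them. *)
apply: (@level_iso1 R); rewrite es in iso'.
case: iso iso' => rho1 e1 [rho2 e2]; exists (rho2^-1 * rho1)%g => k m.
have e3 := e2 ((s^-1)%g k) ((rho2^-1)%g m); rewrite !permKV in e3.
by rewrite perm1 permM -e3 e1 permKV.
Qed.
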